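(* Let $\Omega^*\subset\mathbb{R}^2$ be an equilateral triangle and let $\Omega\subset\mathbb{R}^2$ denote any triangle of the same area. There exist negative numbers $\alpha_1\le\alpha_2$ (which may depend on $\Omega$) such that, for all $\alpha\in(-\infty,\alpha_1]\cup[\alpha_2,0)$, $$\lambda_1^\alpha(\Omega)\le\lambda_1^\alpha(\Omega^* ).$$
   Context: A triangle means the open, non-degenerate triangular domain in $\mathbb{R}^2$. For a bounded Lipschitz domain $\Omega\subset\mathbb{R}^2$ and $\alpha\in\mathbb{R}$, $\lambda_1^\alpha(\Omega)$ denotes the lowest eigenvalue of the Robin Laplacian ($-\Delta u=\lambda u$ in $\Omega$, $\frac{\partial u}{\partial n}+\alpha u=0$ on $\partial\Omega$, with $n$ the outward unit normal), i.e. $$\lambda_1^\alpha(\Omega)=\inf_{u\in H^1(\Omega),\,u\neq0}\frac{\int_\Omega|\nabla u|^2+\alpha\int_{\partial\Omega}|u|^2}{\int_\Omega|u|^2},$$ where the boundary integral is understood in the sense of traces. *)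

(* Defs.v *)
From HB Require Import structures.
From mathcomp Require Import all_boot all_order all_algebra.
From mathcomp Require Import all_classical all_reals all_analysis.
Set Implicit Arguments.
Unset Strict Implicit.
Unset Printing Implicit Defensive.
Import Order.TTheory GRing.Theory Num.Theory.
Import numFieldNormedType.Exports.
Local Open Scope classical_set_scope.
Local Open Scope ring_scope.

(* The product norm of R * R is the sup norm; it is used only for its topology
   and differentiability. Lengths are measured with [dist2]. *)
Definition dist2 (R : realType) (p q : R * R) : R :=
  Num.sqrt ((p.1 - q.1) ^+ 2 + (p.2 - q.2) ^+ 2).

Definition leb2 (R : realType) :
    {measure set (measurableTypeR R * measurableTypeR R) -> \bar R} :=
  (@lebesgue_measure R \x @lebesgue_measure R)%E.

Arguments leb2 : clear implicits.

Record triangle (R : realType) := Triangle {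
  vA : R * R ;
  vB : R * R ;
  vC : R * R ;
  triangle_nondegenerate :
    (vB.1 - vA.1) * (vC.2 - vA.2) - (vC.1 - vA.1) * (vB.2 - vA.2) != 0 }.

Definition domain (R : realType) (T : triangle R) : set (R * R) :=
  [set p | exists a b c : R,
    [/\ 0 < a, 0 < b, 0 < c, a + b + c = 1 &
        p = a *: vA T + b *: vB T + c *: vC T]].

Definition equilateral (R : realType) (T : triangle R) : Prop :=
  dist2 (vA T) (vB T) = dist2 (vB T) (vC T) /\
  dist2 (vB T) (vC T) = dist2 (vC T) (vA T).

Definition edges (R : realType) (T : triangle R) : seq ((R * R) * (R * R)) :=
  [:: (vA T, vB T); (vB T, vC T); (vC T, vA T)].

Definition edge_point (R : realType) (e : (R * R) * (R * R)) (s : R) : R * R :=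
  (1 - s) *: e.1 + s *: e.2.

(* Square-integrable real functions on D; values outside D are irrelevant. *)
Definition L2 d (X : measurableType d) (R : realType)
    (mu : {measure set X -> \bar R}) (D : set X) (f : X -> R) : Prop :=
  measurable_fun D f /\ mu.-integrable D (fun x => (f x ^+ 2)%:E).

(* Integration over the boundary with respect to arc length, each edge e being
   parametrized by [edge_point e] on [0, 1], at constant speed |e|. *)
Definition bd_integral (R : realType) (T : triangle R) (f : R * R -> R) : R :=
  \sum_(e <- edges T) dist2 e.1 e.2 *
    \int[@lebesgue_measure R]_(s in `[0, 1]) f (edge_point e s).

Definition bd_L2 (R : realType) (T : triangle R) (f : R * R -> R) : Prop :=
  forall e, e \in edges T ->
    L2 (@lebesgue_measure R) `[0, 1] (f \o edge_point e).

(* First coordinate for [false], second coordinate for [true]. *)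
Definition basis2 (R : realType) (i : bool) : R * R :=
  if i then (0, 1) else (1, 0).

Definition partial (R : realType) (i : bool) (f : R * R -> R) : R * R -> R :=
  fun p => 'D_(basis2 R i) f p.

(* C^oo on the plane: every iterated partial derivative is differentiable. *)
Definition smooth (R : realType) (f : R * R -> R) : Prop :=
  forall (s : seq bool) (p : R * R),
    differentiable (foldr (@partial R) f s) p.

Definition test_function (R : realType) (W : set (R * R)) (phi : R * R -> R)
    : Prop :=
  [/\ smooth phi,
      compact (closure [set p | phi p != 0]) &
      closure [set p | phi p != 0] `<=` W].

Definition weak_partial (R : realType) (W : set (R * R)) (i : bool)
    (u g : R * R -> R) : Prop :=
  forall phi, test_function W phi ->
    \int[leb2 R]_(p in W) (u p * partial i phi p) =
    - \int[leb2 R]_(p in W) (g p * phi p).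

(* u belongs to H^1(W) and (g false, g true) is its weak gradient. *)
Definition H1 (R : realType) (W : set (R * R)) (u : R * R -> R)
    (g : bool -> R * R -> R) : Prop :=
  [/\ L2 (leb2 R) W u, (forall i, L2 (leb2 R) W (g i)) &
      (forall i, weak_partial W i u (g i))].

(* t is (a representative of) the trace of u: the image of u under the
   continuous extension to H^1 of the restriction of smooth functions to the
   boundary. That is, some functions smooth up to the boundary converge to u
   in H^1 while their boundary values converge to t in L^2. *)
Definition is_trace (R : realType) (T : triangle R) (u : R * R -> R)
    (g : bool -> R * R -> R) (t : R * R -> R) : Prop :=
  bd_L2 T t /\
  exists v : nat -> R * R -> R,
    [/\ (forall n, smooth (v n)),
        (\int[leb2 R]_(p in domain T) ((v n p - u p) ^+ 2)%:E)%E
          @[n --> \oo] --> 0%E,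
        (forall i : bool,
          (\int[leb2 R]_(p in domain T) ((partial i (v n) p - g i p) ^+ 2)%:E)%E
            @[n --> \oo] --> 0%E) &
        bd_integral T (fun p => (v n p - t p) ^+ 2) @[n --> \oo] --> (0 : R)].

Definition robin_quotient (R : realType) (alpha : R) (T : triangle R)
    (u : R * R -> R) (g : bool -> R * R -> R) (t : R * R -> R) : R :=
  (\int[leb2 R]_(p in domain T) (g false p ^+ 2 + g true p ^+ 2)
     + alpha * bd_integral T (fun p => t p ^+ 2))
  / \int[leb2 R]_(p in domain T) (u p ^+ 2).

(* The infimum is taken in the extended reals, so that no junk value can arise
   from an empty or unbounded set. *)
Definition lambda1 (R : realType) (alpha : R) (T : triangle R) : \bar R :=
  ereal_inf [set q : \bar R |
    exists (u : R * R -> R) (g : bool -> R * R -> R) (t : R * R -> R),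
      [/\ H1 (domain T) u g,
          ~ {ae leb2 R, forall p, domain T p -> u p = 0},
          is_trace T u g t &
          q = (robin_quotient alpha T u g t)%:E]].

(* Main.v *)
Require Import Defs.
From mathcomp Require Import all_boot all_order all_algebra.
From mathcomp Require Import all_classical all_reals all_analysis.
From mathcomp Require Import measurable_realfun ring lra.
Set Implicit Arguments.
Unset Strict Implicit.
Unset Printing Implicit Defensive.
Import Order.TTheory GRing.Theory Num.Theory.
Import numFieldNormedType.Exports.
Local Open Scope classical_set_scope.
Local Open Scope ring_scope.

(** Write t = - alpha > 0. Everything follows from the divergence theorem on a
    triangle, [divergence_triangle].

    Bounds from above ([lambda1_le_exp_dot], [lambda1_le_cst]). For a vector w,
    the function u(p) = exp(w . p) satisfies |grad u|^2 = |w|^2 u^2 and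
    div (u^2 w) = 2 |w|^2 u^2. If w . n <= t on the boundary, the divergence
    theorem gives 2 |w|^2 int u^2 <= t int_bd u^2, hence the Robin quotient of u
    is at most - |w|^2. The admissible w form a copy of the triangle T, moved
    and scaled so that its incircle is centred at 0 with radius t. The best w is
    its farthest vertex, whence lambda1 <= - k t^2 with k the largest value of
    (distance from incentre to vertex / inradius)^2; and k > 4 unless T is
    equilateral ([lambda1_le_nonequilateral]). For w = 0 the test function is
    constant and lambda1 <= - t * perimeter / area.

    Bound from below ([lambda1_ge_incircle], [lambda1_ge_equilateral]). Let I be
    the incentre, r the inradius and F(p) = (t / r) (p - I), so that F . n = t on
    every edge. Integrating |grad v|^2 >= div (v^2 F) - v^2 (div F + |F|^2) gives,
    on an equilateral triangle, where |p - I| <= 2 r,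
    lambda1 >= - t * perimeter / area - 4 t^2.

    Comparison. For large t, the inequality k > 4 wins; for small t, what counts
    is that among triangles of given area only the equilateral one minimises the
    perimeter ([perimeter_gt_equilateral]). If T is equilateral, it is congruent
    to the other triangle and both have the same lowest eigenvalue
    ([lambda1_le_congruent]).

    All these arguments take place on smooth functions: a smooth function is
    admissible with its classical gradient and boundary values
    ([lambda1_le_smooth]), and each admissible triple is by the definition of
    the trace a limit of smooth ones, along which the quotient converges
    ([lambda1_ge_smooth]). *)

(** * Affine changes of variables *)

Section affine1.
Context {R : realType}.
Notation mu := (@lebesgue_measure R).

Lemma measurable_affine1 (a b : R) :
  measurable_fun [set: measurableTypeR R]
    ((fun x => a * x + b) : measurableTypeR R -> measurableTypeR R).
Proof.
apply: measurable_funD; last exact: measurable_cst.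
exact: mulrl_measurable.
Qed.

(** Lebesgue measure is determined by half-open intervals, whose preimages under
    a non-constant affine map are intervals, closed on the left instead of the
    right when the slope is negative. *)
Lemma lebesgue_measure_affine (a b : R) (X : set (measurableTypeR R)) :
  a != 0 -> measurable X ->
  mu X = (`|a|%:E * mu ((fun x => (a * x + b)%R) @^-1` X))%E.
Proof.
move=> a0 mX.
pose phi : measurableTypeR R -> measurableTypeR R := fun x => a * x + b.
pose pf := measure_function_pushforward__canonical__measure_function_Measure
  mu (measurable_affine1 a b).
pose k : {nonneg R} := NngNum (normr_ge0 a).
pose nu := mscale k pf.
have := @lebesgue_measure_unique R nu _ X mX; apply.
move=> _ /= [[x y] _ <-] /=.
rewrite lebesgue_measure_itv /=.
rewrite /nu /mscale/= /pushforward -/phi.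
have [ap|an|a00] := ltgtP 0 a; last by rewrite -a00 eqxx in a0.
- have -> : phi @^-1` `]x, y] = `]((x-b)/a), ((y-b)/a)]%classic.
    apply/seteqP; split => z /=; rewrite !in_itv/= ltr_pdivrMr//;
      by rewrite ler_pdivlMr// /phi => /andP[? ?]; apply/andP; split; nra.
  rewrite lebesgue_measure_itv /= !lte_fin ltr_pM2r ?invr_gt0// ltrD2r.
  rewrite gtr0_norm//; case: ifP => _; rewrite ?mule0//.
  rewrite -EFinD -EFinD -EFinM; congr EFin; by field.
- have -> : phi @^-1` `]x, y] = `[((y-b)/a), ((x-b)/a)[%classic.
    apply/seteqP; split => z /=; rewrite !in_itv/= ltr_ndivlMr//;
      by rewrite ler_ndivrMr// /phi => /andP[? ?]; apply/andP; split; nra.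
  rewrite lebesgue_measure_itv /= !lte_fin ltr_nM2r ?invr_lt0// ltrD2r.
  rewrite ltr0_norm//; case: ifP => _; rewrite ?mule0//.
  rewrite -EFinD -EFinD -EFinM; congr EFin; by field; rewrite ?lt_eqF.
Qed.

Lemma ge0_integral_affine (a b : R) (f : measurableTypeR R -> \bar R) :
  a != 0 -> measurable_fun setT f -> (forall x, 0 <= f x)%E ->
  (\int[mu]_x f x = `|a|%:E * \int[mu]_x f (a * x + b)%R)%E.
Proof.
move=> a0 mf f0.
pose phi : measurableTypeR R -> measurableTypeR R := fun x => a * x + b.
pose pf := measure_function_pushforward__canonical__measure_function_Measure
  mu (measurable_affine1 a b).
pose k : {nonneg R} := NngNum (normr_ge0 a).
pose nu := mscale k pf.
rewrite (@eq_measure_integral _ _ _ _ nu); last first.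
  by move=> A mA _; exact: (lebesgue_measure_affine b a0 mA).
rewrite ge0_integral_mscale//.
rewrite ge0_integral_pushforward//; last exact: measurable_affine1.
Qed.
End affine1.

Section open2.
Context {R : realType}.
Notation R2 := (measurableTypeR R * measurableTypeR R)%type.

(** The measurable structure of the plane is a product of Borel structures, so
    an open set has to be written as a countable union of open boxes; rational
    centres and sizes suffice. *)
Lemma open_measurable2 (U : set (R * R)) :
  open U -> measurable (U : set R2).
Proof.
move=> oU.
pose box (q1 q2 r : rat) : set R2 :=
  ball (ratr q1 : R) (ratr r) `*` ball (ratr q2 : R) (ratr r).
pose F q1 q2 r := if pselect (box q1 q2 r `<=` U) then box q1 q2 r else set0.
have -> : U = \bigcup_q1 \bigcup_q2 \bigcup_r F q1 q2 r.
  apply/seteqP; split => [p Up|p [q1 _] [q2 _] [r _]]; last first.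
    by rewrite /F; case: pselect => // bU /bU.
  have /nbhs_ballP[e /= e0 eU] := open_nbhs_nbhs (conj oU Up).
  have [r] := @rat_in_itvoo R 0 (e / 2) (divr_gt0 e0 (ltr0n _ 2)).
  rewrite in_itv/= => /andP[r0 re].
  have near (x : R) : exists q, ball (ratr q : R) (ratr r) x.
    have [q] := @rat_in_itvoo R x (x + ratr r) ltac:(lra).
    rewrite in_itv/= => /andP[xq qx]; exists q.
    by rewrite /ball/= gtr0_norm; lra.
  have [q1 q1p] := near p.1; have [q2 q2p] := near p.2.
  exists q1 => //; exists q2 => //; exists r => //.
  rewrite /F; case: pselect => [//|]; case => -[x y] [/= xq yq]; apply: eU.
  have le_e : ratr r + ratr r <= e :> R by lra.
  split => /=; apply: (le_ball le_e).
    exact: ball_triangle (ball_sym q1p) xq.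
  exact: ball_triangle (ball_sym q2p) yq.
apply: bigcupT_measurable_rat => q1; apply: bigcupT_measurable_rat => q2.
apply: bigcupT_measurable_rat => r; rewrite /F; case: pselect => bU.
  by apply: measurableX; exact: measurable_ball.
exact: measurable0.
Qed.

Lemma continuous_measurable_fun2 (f : R * R -> R) :
  continuous f -> measurable_fun setT (f : R2 -> R).
Proof.
move=> /continuousP cf; apply: (measurability _ (RGenOpens.measurableE R)) => //.
move=> _ [_ [a [b ->] <-]]; rewrite setTI.
apply: open_measurable2; apply: cf; exact: interval_open.
Qed.
End open2.

Section affine2.
Context {R : realType}.
Notation mu := (@lebesgue_measure R).
Notation R2 := (measurableTypeR R * measurableTypeR R)%type.

(** By Tonelli only one-dimensional substitutions are needed: first x, at fixed y,
    with slope a; then y, at a fixed value of the new first coordinate, with slope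
    det / a. *)
Lemma ge0_iterated_affine (a b c d e g : R) (f : R2 -> \bar R) :
  a != 0 -> a * d - b * c != 0 ->
  measurable_fun setT f -> (forall p, 0 <= f p)%E ->
  (\int[mu]_x \int[mu]_y f (x, y) = `|a * d - b * c|%:E *
    \int[mu]_y \int[mu]_x f (a * x + b * y + e, c * x + d * y + g)%R)%E.
Proof.
move=> a0 det0 mf f0.
have mL (k l m : R) : measurable_fun setT
    (fun p : R2 => (k * p.1 + l * p.2 + m : measurableTypeR R)).
  apply: measurable_funD; last exact: measurable_cst.
  by apply: measurable_funD; apply: measurable_funM => //; exact: measurable_cst.
(* The integrand after the substitution in x alone. *)
pose h : R2 -> \bar R := fun p =>
  f (p.1, (a * d - b * c) / a * p.2 + (c / a * (p.1 - e) + g)).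
have mh : measurable_fun setT h.
  apply: (measurableT_comp mf); apply: measurable_fun_pair => //=.
  rewrite (_ : (fun x => _) = fun p : R2 =>
    (c / a) * p.1 + (a * d - b * c) / a * p.2 + (g - c / a * e)).
    exact: mL.
  by apply/funext => p /=; ring.
transitivity (`|(a * d - b * c) / a|%:E * \int[mu]_x \int[mu]_y h (x, y))%E.
  rewrite -ge0_integralZl//=; last 2 first.
  - exact: (measurable_fun_fubini_tonelli_F h mh (fun p => f0 _)).
  - by move=> x _; apply: integral_ge0 => y0 _; exact: f0.
  apply: eq_integral => x _; rewrite /h/=.
  rewrite -(@ge0_integral_affine _ ((a * d - b * c) / a)
    (c / a * (x - e) + g) (fun y => f (x, y)))//.
    by rewrite mulf_neq0// invr_neq0.
  by apply: measurableT_comp => //; exact: pair1_measurable.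
rewrite (fubini_tonelli h mh (fun p => f0 _)).
have -> : `|a * d - b * c|%:E = (`|(a * d - b * c) / a|%:E * `|a|%:E)%E.
  by rewrite -EFinM -normrM divfK.
rewrite -muleA; congr *%E.
rewrite -ge0_integralZl//=; last 2 first.
- apply: (measurable_fun_fubini_tonelli_G (fun p : R2 =>
    f (a * p.1 + b * p.2 + e, c * p.1 + d * p.2 + g)%R)) => //.
  by apply: (measurableT_comp mf); apply: measurable_fun_pair => //=; exact: mL.
- by move=> x _; apply: integral_ge0 => y0 _; exact: f0.
apply: eq_integral => y _.
rewrite (@ge0_integral_affine _ a (b * y + e) (fun x => h (x, y)))//.
  congr *%E; apply: eq_integral => x _; rewrite /h /=.
  congr (f (_, _)); first by ring.
  by field.
  by apply: measurableT_comp => //; exact: pair2_measurable.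
by move=> x; exact: f0.
Qed.

Lemma ge0_integral_affine2 (a b c d e g : R) (f : R2 -> \bar R) :
  a * d - b * c != 0 ->
  measurable_fun setT f -> (forall p, 0 <= f p)%E ->
  (\int[leb2 R]_p f p = `|a * d - b * c|%:E *
    \int[leb2 R]_p f (a * p.1 + b * p.2 + e, c * p.1 + d * p.2 + g)%R)%E.
Proof.
move=> det0 mf f0.
have mL (k l m : R) : measurable_fun setT
    (fun p : R2 => (k * p.1 + l * p.2 + m : measurableTypeR R)).
  apply: measurable_funD; last exact: measurable_cst.
  by apply: measurable_funD; apply: measurable_funM => //; exact: measurable_cst.
pose h := (fun p : R2 => f (a * p.1 + b * p.2 + e, c * p.1 + d * p.2 + g)%R).
have mh : measurable_fun setT h.
  by apply: (measurableT_comp mf); apply: measurable_fun_pair => //=; exact: mL.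
rewrite /leb2 (fubini_tonelli1 f)//.
have [a0|a0] := eqVneq a 0; last first.
  by rewrite (fubini_tonelli2 h mh (fun p => f0 _)); exact: ge0_iterated_affine.
(* When a = 0 then b != 0, and exchanging the two variables exchanges the
   columns of the matrix. *)
have b0 : b != 0 by apply: contraNneq det0 => ->; rewrite a0 !mul0r subr0.
rewrite (fubini_tonelli1 h mh (fun p => f0 _)) distrC.
have det0' : b * c - a * d != 0 by rewrite -oppr_eq0 opprB.
apply: (eq_trans (@ge0_iterated_affine b a d c e g f b0 det0' mf f0)).
congr *%E; apply: eq_integral => x _; apply: eq_integral => y _; rewrite /h /=.
by congr (f (_, _)); ring.
Qed.
End affine2.

(** * Integration over a triangle through its affine chart *)

Section planar_integrals.
Context {R : realType}.
Notation R2 := (measurableTypeR R * measurableTypeR R)%type.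
Implicit Types (T : triangle R) (D : set (R * R)) (f : R * R -> R).

Lemma continuous_affine (k l m : R) :
  continuous (fun p : R * R => k * p.1 + l * p.2 + m).
Proof.
move=> p; apply: cvgD; last exact: cvg_cst.
by apply: cvgD; apply: cvgM; try exact: cvg_cst; [exact: cvg_fst|exact: cvg_snd].
Qed.

Lemma continuous_pair (X : topologicalType) (h k : X -> R) :
  continuous h -> continuous k -> continuous (fun x => (h x, k x)).
Proof. move=> ch ck x; exact: (cvg_pair (ch x) (ck x)). Qed.

Lemma bounded_domain_measure_lty D (M : R) : measurable (D : set R2) ->
  (forall p, D p -> `|p.1| <= M /\ `|p.2| <= M) -> (leb2 R D < +oo)%E.
Proof.
move=> mD DM.
apply: (@le_lt_trans _ _ (leb2 R (`[- M, M]%classic `*` `[- M, M]%classic))).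
  apply: le_measure; rewrite ?inE//.
    by apply: measurableX; exact: measurable_itv.
  move=> p /DM[]; rewrite !ler_norml => p1 p2; split => /=; rewrite in_itv/=; lra.
rewrite /leb2 [X in (X < _)%E]product_measure1E//; try exact: measurable_itv.
have fin : (@lebesgue_measure R [set` `[(- M)%R, M]] < +oo)%E.
  by rewrite lebesgue_measure_itv /=; case: ifP => _; rewrite -?EFinB ltry.
by rewrite lte_mul_pinfty// ge0_fin_numE.
Qed.

(** A continuous function is bounded on D because D lies in a compact box. *)
Lemma continuous_integrable2 D (M : R) f : measurable (D : set R2) ->
  (forall p, D p -> `|p.1| <= M /\ `|p.2| <= M) -> continuous f ->
  (leb2 R).-integrable D (EFin \o f).
Proof.
move=> mD DM cf; apply: measurable_bounded_integrable => //.
- exact: bounded_domain_measure_lty DM.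
- by apply: measurable_funTS; exact: continuous_measurable_fun2.
- have cK : compact (f @` (`[- M, M]%classic `*` `[- M, M]%classic)).
    apply: continuous_compact; first exact: continuous_subspaceT.
    by apply: compact_setX; exact: segment_compact.
  have [N [Nr NP]] := compact_bounded cK.
  exists N; split => // x Nx p Dp; apply: NP => //; exists p => //.
  have [] := DM p Dp; rewrite !ler_norml => p1 p2.
  by split => /=; rewrite in_itv/=; lra.
Qed.

Definition ref_triangle : set (R * R) :=
  [set p | [/\ 0 < p.1, 0 < p.2 & p.1 + p.2 < 1]].

Definition cross (u v : R * R) : R := u.1 * v.2 - u.2 * v.1.

(** Twice the signed area. *)
Definition tdet T : R := cross (vB T - vA T) (vC T - vA T).

Lemma tdet_neq0 T : tdet T != 0.
Proof.
by rewrite /tdet /cross (mulrC (vB T - vA T).2); exact: triangle_nondegenerate.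
Qed.

(** The affine map that takes the vertices (0, 0), (1, 0), (0, 1) of
    [ref_triangle] to A, B, C: its arguments are the barycentric coordinates with
    respect to B and C. *)
Definition chart T (p : R * R) : R * R :=
  ((vB T - vA T).1 * p.1 + (vC T - vA T).1 * p.2 + (vA T).1,
   (vB T - vA T).2 * p.1 + (vC T - vA T).2 * p.2 + (vA T).2).

Definition chart_inv T (q : R * R) : R * R :=
  (cross (q - vA T) (vC T - vA T) / tdet T,
   cross (vB T - vA T) (q - vA T) / tdet T).

Lemma chart_invK T : cancel (chart_inv T) (chart T).
Proof.
move=> [x y]; have := tdet_neq0 T; rewrite /chart_inv /chart /tdet /cross /= => h.
by congr pair; field.
Qed.

Lemma chartK T : cancel (chart T) (chart_inv T).
Proof.
move=> [x y]; have := tdet_neq0 T; rewrite /chart_inv /chart /tdet /cross /= => h.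
by congr pair; field.
Qed.

Lemma continuous_chart T : continuous (chart T).
Proof. by apply: continuous_pair; exact: continuous_affine. Qed.

Lemma continuous_chart_inv T : continuous (chart_inv T).
Proof.
apply: continuous_pair.
  rewrite (_ : (fun x => _) = fun q : R * R =>
    (vC T - vA T).2 / tdet T * q.1 + (- (vC T - vA T).1 / tdet T) * q.2
    + (- cross (vA T) (vC T - vA T)) / tdet T).
    exact: continuous_affine.
  by apply/funext => q; rewrite /cross /=; ring.
rewrite (_ : (fun x => _) = fun q : R * R =>
  (- (vB T - vA T).2) / tdet T * q.1 + ((vB T - vA T).1 / tdet T) * q.2
  + (- cross (vB T - vA T) (vA T)) / tdet T).
  exact: continuous_affine.
by apply/funext => q; rewrite /cross /=; ring.
Qed.

Lemma domain_chart T p : domain T (chart T p) <-> ref_triangle p.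
Proof.
split.
  move=> [a [b [c [a0 b0 c0 abc]]]] E.
  have -> : p = (b, c).
    rewrite -(chartK T p) E -[RHS](chartK T); congr (chart_inv T _).
    have -> : a = 1 - b - c by lra.
    by rewrite /chart; congr pair; rewrite /= /GRing.scale /=; ring.
  by split => /=; lra.
move=> [p1 p2 p12]; exists (1 - p.1 - p.2), p.1, p.2; split; [lra|lra|lra|lra|].
by rewrite /chart; congr pair; rewrite /= /GRing.scale /=; ring.
Qed.

Lemma domainE T : domain T = chart_inv T @^-1` ref_triangle.
Proof.
apply/seteqP; split => q /= h; last first.
  by rewrite -(chart_invK T q); exact/domain_chart.
by apply/(domain_chart T); rewrite chart_invK.
Qed.

Lemma open_ref : open ref_triangle.
Proof.
have -> : ref_triangle =
    [set p : R * R | 0 < p.1] `&` [set p | 0 < p.2] `&` [set p | p.1 + p.2 < 1].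
  by apply/seteqP; split => p /= [] => [? ? ?|[? ?] ?]; split.
have o1 (k l m : R) : open [set p : R * R | 0 < k * p.1 + l * p.2 + m].
  by apply: (open_comp _ (@open_gt _ 0)) => p _; exact: continuous_affine.
apply: openI; first apply: openI.
- by have := o1 1 0 0; congr open; apply/seteqP; split => p /=; lra.
- by have := o1 0 1 0; congr open; apply/seteqP; split => p /=; lra.
- by have := o1 (-1) (-1) 1; congr open; apply/seteqP; split => p /=; lra.
Qed.

Lemma open_domain T : open (domain T).
Proof.
rewrite domainE; apply: (open_comp _ open_ref) => p _.
exact: continuous_chart_inv.
Qed.

Lemma measurable_ref : measurable (ref_triangle : set R2).
Proof. exact: open_measurable2 open_ref. Qed.

Lemma measurable_domain T : measurable (domain T : set R2).
Proof. exact: open_measurable2 (@open_domain T). Qed.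

Lemma bounded_domain T :
  exists M, forall p, domain T p -> `|p.1| <= M /\ `|p.2| <= M.
Proof.
exists (`|vA T| + `|vB T| + `|vC T|) => p [a [b [c [a0 b0 c0 abc ->]]]] /=.
have tri (x y z : R) : `|a * x + b * y + c * z| <= `|x| + `|y| + `|z|.
  have sc (k w : R) : 0 < k -> k < 1 -> `|k * w| <= `|w|.
    by move=> k0 k1; rewrite normrM gtr0_norm// ler_piMl// ltW.
  rewrite (le_trans (ler_normD _ _))// lerD// ?sc//; try lra.
  by rewrite (le_trans (ler_normD _ _))// lerD// sc//; lra.
have n1 (q : R * R) : `|q.1| <= `|q| /\ `|q.2| <= `|q|.
  by rewrite prod_normE !le_max !lexx orbT.
have [[A1 A2] [B1 B2] [C1 C2]] := And3 (n1 (vA T)) (n1 (vB T)) (n1 (vC T)).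
by split; apply: (le_trans (tri _ _ _)); lra.
Qed.

Lemma integrable_domain T f : continuous f ->
  (leb2 R).-integrable (domain T) (EFin \o f).
Proof.
have [M DM] := bounded_domain T.
exact: continuous_integrable2 (@measurable_domain T) DM.
Qed.

Lemma integrable_ref f :
  continuous f -> (leb2 R).-integrable ref_triangle (EFin \o f).
Proof.
apply: (@continuous_integrable2 _ 1); first exact: measurable_ref.
by move=> p [? ? ?]; rewrite !ger0_norm; lra.
Qed.

Lemma ge0_integral_domain T (f : R2 -> \bar R) : measurable_fun setT f ->
  (forall p, 0 <= f p)%E ->
  (\int[leb2 R]_(p in domain T) f p =
   `|tdet T|%:E * \int[leb2 R]_(p in ref_triangle) f (chart T p))%E.
Proof.
move=> mf f0; rewrite integral_mkcond [in RHS]integral_mkcond.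
have E : (vB T - vA T).1 * (vC T - vA T).2
    - (vC T - vA T).1 * (vB T - vA T).2 = tdet T.
  by rewrite /tdet /cross /=; ring.
rewrite (@ge0_integral_affine2 _ (vB T - vA T).1 (vC T - vA T).1
  (vB T - vA T).2 (vC T - vA T).2 (vA T).1 (vA T).2); last 3 first.
- by rewrite E tdet_neq0.
- apply/(measurable_restrictT f (@measurable_domain T)).
  exact: measurable_funTS.
- by move=> p; rewrite patchE; case: ifP.
rewrite E; congr *%E; apply: eq_integral => p _.
rewrite -/(chart T p) !patchE.
suff -> : (chart T p \in domain T) = (p \in ref_triangle) by [].
by apply/idP/idP; rewrite !inE => /domain_chart.
Qed.

Lemma Rintegral_domain T f : continuous f ->
  \int[leb2 R]_(p in domain T) f p =
  `|tdet T| * \int[leb2 R]_(p in ref_triangle) f (chart T p).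
Proof.
move=> cf; rewrite /Rintegral.
have cfT : continuous (f \o chart T).
  by move=> p; apply: continuous_comp; [exact: continuous_chart|exact: cf].
have mf : measurable_fun setT (EFin \o f : R2 -> _).
  by apply/measurable_EFinP; exact: continuous_measurable_fun2.
have iT := integrable_ref cfT.
have Fp := integrable_pos_fin_num measurable_ref iT.
have Fn := integrable_neg_fin_num measurable_ref iT.
rewrite [in LHS]integralE [in RHS]integralE.
rewrite !ge0_integral_domain//; last 2 first.
- exact: measurable_funeneg.
- exact: measurable_funepos.
have -> : (\int[leb2 R]_(p in ref_triangle) (EFin \o f)^\+ (chart T p) =
    \int[leb2 R]_(p in ref_triangle) (EFin \o (f \o chart T))^\+ p)%E.
  by apply: eq_integral => p _; rewrite !funeposE.
have -> : (\int[leb2 R]_(p in ref_triangle) (EFin \o f)^\- (chart T p) =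
    \int[leb2 R]_(p in ref_triangle) (EFin \o (f \o chart T))^\- p)%E.
  by apply: eq_integral => p _; rewrite !funenegE.
rewrite -muleBr//; last by rewrite fin_num_adde_defl// fin_numN.
by rewrite fineM// fin_numB Fp.
Qed.

End planar_integrals.

(** * The divergence theorem on a triangle *)

Section divergence.
Context {R : realType}.
Notation mu := (@lebesgue_measure R).
Implicit Types (T : triangle R) (f : R * R -> R) (e : (R * R) * (R * R)).

Definition C1 f : Prop :=
  (forall p, differentiable f p) /\ (forall i, continuous (partial i f)).

Lemma C1_continuous f : C1 f -> continuous f.
Proof. by move=> [df _] p; apply: differentiable_continuous. Qed.

Lemma derive_partial f w p : differentiable f p ->
  'D_w f p = w.1 * partial false f p + w.2 * partial true f p.
Proof.
move=> df; rewrite /partial !deriveE// /basis2.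
rewrite -[X in X + _]linearZ -[X in _ + X]linearZ -linearD; congr ('d f p _).
by case: w => a b; congr pair; rewrite /= /GRing.scale/=; ring.
Qed.

Lemma C1_continuous_derive f w : C1 f -> continuous (fun p => 'D_w f p).
Proof.
move=> [df cf]; rewrite (_ : (fun p => _) = fun p =>
  w.1 * partial false f p + w.2 * partial true f p); last first.
  by apply/funext => p; rewrite derive_partial.
by move=> p; apply: cvgD; apply: cvgM;
  [exact: cvg_cst|exact: cf|exact: cvg_cst|exact: cf].
Qed.

(** Both difference quotients are the same function of the increment. *)
Lemma derive_along f (P w : R * R) (s : R) :
  (derivable (fun s : R => f (P + s *: w)) s 1 <-> derivable f (P + s *: w) w) /\
  'D_1 (fun s : R => f (P + s *: w)) s = 'D_w f (P + s *: w).
Proof.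
rewrite /derivable /derive.
suff -> : (fun h : R => h^-1 *:
    (((fun s : R => f (P + s *: w)) \o shift s) (h *: 1) - f (P + s *: w)))
  = (fun h => h^-1 *: ((f \o shift (P + s *: w)) (h *: w) - f (P + s *: w)))
  by [].
apply/funext => h /=; congr (_ *: (f _ - _)).
by rewrite [h *: 1]mulr1 scalerDl addrCA.
Qed.

(** Fubini, then the fundamental theorem of calculus on each horizontal slice
    ]0, 1 - y[ of the reference triangle. *)
Lemma integral_ref_dx (F g : R * R -> R) :
  (forall x y, derivable (fun z => F (z, y)) x 1 /\
     'D_1 (fun z => F (z, y)) x = g (x, y)) ->
  continuous F -> continuous g ->
  \int[leb2 R]_(p in @ref_triangle R) g p =
  \int[mu]_(y in `[0, 1]) (F (1 - y, y) - F (0, y)).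
Proof.
move=> dF cF cg.
have cline (G : R * R -> R) (a b : R -> R) : continuous G -> continuous a ->
    continuous b -> continuous (fun y => G (a y, b y)).
  move=> cG ca cb z.
  apply: (@continuous_comp _ _ _ (fun y => (a y, b y)) G); last exact: cG.
  exact: (continuous_pair ca cb).
have cid : continuous (fun y : R => y) by move=> z; exact: cvg_id.
have ccst (c : R) : continuous (fun y : R => c) by move=> z; exact: cvg_cst.
have c1B : continuous (fun y : R => 1 - y).
  by move=> z; apply: cvgB; [exact: cvg_cst|exact: cvg_id].
rewrite /Rintegral; congr fine.
(* At y = 0 the slice is empty while the right-hand integrand need not vanish:
   the end points are removed first. *)
rewrite (@integral_itv_bndoo _ 0 1 _ true false); last first.
  apply: measurable_funTS; apply/measurable_EFinP; apply: continuous_measurable_fun.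
  move=> z; apply: cvgB; first exact: (cline F (fun y => 1 - y) id cF c1B cid).
  exact: (cline F (fun=> 0) id cF (ccst 0) cid).
have ig := integrable_ref cg.
rewrite integral_mkcond [in RHS]integral_mkcond.
have {}ig := (integrable_mkcond _ measurable_ref).1 ig.
rewrite /leb2 -(integral21_prod_meas1 ig).
apply: eq_integral => y _; rewrite /fubini_G patchE.
case: ifPn => [|y01]; last first.
  apply: integral0_eq => x _; rewrite patchE ifF//; apply/negbTE.
  apply: contra y01; rewrite !inE /= in_itv/= => -[/= ? ? ?]; lra.
rewrite inE/= in_itv/= => /andP[y0 y1].
transitivity (\int[mu]_(x in `]0%R, (1 - y)%R[) (g (x, y))%:E)%E.
  rewrite [RHS]integral_mkcond; apply: eq_integral => x _; rewrite !patchE.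
  suff -> : ((x, y) \in @ref_triangle R) = (x \in `]0, 1 - y[%classic) by [].
  apply/idP/idP; rewrite !inE /= in_itv/=; first by move=> [/= ? ? ?]; lra.
  by move=> /andP[? ?]; split => /=; lra.
have cgy : continuous (fun x => g (x, y)).
  exact: (cline g id (fun=> y) cg cid (ccst y)).
have cFy : continuous (fun x => F (x, y)).
  exact: (cline F id (fun=> y) cF cid (ccst y)).
rewrite -(@integral_itv_bndoo _ 0 (1 - y) _ true false); last first.
  by apply: measurable_funTS; apply/measurable_EFinP; exact: continuous_measurable_fun.
rewrite (@continuous_FTC2 _ _ (fun x => F (x, y)))//.
- lra.
- exact: continuous_subspaceT.
- split; first by move=> x _; have [] := dF x y.
    exact: (cvg_at_right_filter (cFy _)).
  exact: (cvg_at_left_filter (cFy _)).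
- by move=> x _; rewrite derive1E; have [] := dF x y.
Qed.

(** The parameter has constant speed on e, so that the integral with respect to
    arc length is [dist2 e.1 e.2] times this one. *)
Definition edge_integral e f : R := \int[mu]_(s in `[0, 1]) f (edge_point e s).

Lemma continuous_edge_point e : continuous (edge_point e).
Proof.
rewrite (_ : edge_point e = fun s =>
  ((1 - s) * e.1.1 + s * e.2.1, (1 - s) * e.1.2 + s * e.2.2))//.
apply: continuous_pair => s; apply: cvgD; apply: cvgM; try exact: cvg_cst; try exact: cvg_id;
 by apply: cvgB; [exact: cvg_cst|exact: cvg_id].
Qed.

Lemma continuous_edge e f :
  continuous f -> continuous (fun s => f (edge_point e s)).
Proof.
move=> cf s; apply: continuous_comp; last exact: cf.
exact: continuous_edge_point.
Qed.

Lemma integrable01 (h : R -> R) :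
  continuous h -> mu.-integrable `[0, 1] (EFin \o h).
Proof.
move=> ch; apply: continuous_compact_integrable; first exact: segment_compact.
exact: continuous_subspaceT.
Qed.

Lemma edge_integral_rev (P Q : R * R) f :
  continuous f -> edge_integral (Q, P) f = edge_integral (P, Q) f.
Proof.
move=> cf; rewrite /edge_integral Rintegration_by_substitution_onem; last 2 first.
- by rewrite ler01 lexx.
- by apply: continuous_subspaceT; exact: continuous_edge.
rewrite unstable.onem1; apply: eq_Rintegral => s _.
by rewrite /edge_point /unstable.onem opprB addrCA subrr addr0 addrC.
Qed.

(** In the chart, differentiating along B - A means differentiating in the first
    coordinate, and the two ends of the horizontal slices run along BC and AC. *)
Lemma integral_derive_AB T f : C1 f ->
  \int[leb2 R]_(p in domain T) 'D_(vB T - vA T) f p =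
  `|tdet T| * (edge_integral (vB T, vC T) f - edge_integral (vC T, vA T) f).
Proof.
move=> cf; rewrite Rintegral_domain; last exact: C1_continuous_derive.
have cf0 := C1_continuous cf.
congr *%R; rewrite (@integral_ref_dx (f \o chart T)).
- rewrite (edge_integral_rev (vA T) (vC T) cf0) /edge_integral.
  rewrite -RintegralB//; last 2 first.
  + by apply: integrable01; exact: continuous_edge.
  + by apply: integrable01; exact: continuous_edge.
  apply: eq_Rintegral => y _ /=; congr (f _ - f _);
   by rewrite /chart /edge_point; congr pair; rewrite /= /GRing.scale/=; ring.
- move=> x y; have E : (fun z => (f \o chart T) (z, y)) =
    (fun z : R => f (chart T (0, y) + z *: (vB T - vA T))).
    apply/funext => z /=; congr f.
    by rewrite /chart; congr pair; rewrite /= /GRing.scale/=; ring.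
  have Ex : chart T (x, y) = chart T (0, y) + x *: (vB T - vA T).
    by rewrite /chart; congr pair; rewrite /= /GRing.scale/=; ring.
  rewrite E Ex; have [dd ->] := derive_along f (chart T (0, y)) (vB T - vA T) x.
  by split => //; apply/dd; apply: diff_derivable; exact: cf.1.
- by move=> p; apply: continuous_comp; [exact: continuous_chart|exact: cf0].
- move=> p.
  apply: (@continuous_comp _ _ _ (chart T) (fun q => 'D_(vB T - vA T) f q)).
    exact: continuous_chart.
  exact: C1_continuous_derive.
Qed.

Lemma flip_nondegenerate T :
  ((vC T).1 - (vA T).1) * ((vB T).2 - (vA T).2)
  - ((vB T).1 - (vA T).1) * ((vC T).2 - (vA T).2) != 0.
Proof. by rewrite -oppr_eq0 opprB; exact: triangle_nondegenerate. Qed.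

(** Exchanging the labels B and C turns the formula for the derivative along B - A
    into the one along C - A. *)
Definition flip T : triangle R := Triangle (flip_nondegenerate T).

Lemma domain_flip T : domain (flip T) = domain T.
Proof.
by apply/seteqP; split => p [a [b [c [a0 b0 c0 abc ->]]]]; exists a, c, b;
  split=> //; [rewrite addrAC|rewrite addrAC|rewrite addrAC|rewrite addrAC].
Qed.

(** The inner product of w with the outward normal of e, times the length of e.
    Turning e.2 - e.1 clockwise gives the outward normal when A, B, C are
    listed counterclockwise; the sign of [tdet] takes care of the other
    orientation. *)
Definition flux T (w : R * R) e : R := Num.sg (tdet T) * cross w (e.2 - e.1).

(** Both sides are linear in w, and B - A, C - A form a basis of the plane. *)
Lemma divergence_triangle T w f : C1 f ->
  \int[leb2 R]_(p in domain T) 'D_w f p =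
  \sum_(e <- edges T) flux T w e * edge_integral e f.
Proof.
move=> cf.
have cf0 := C1_continuous cf.
have d0 := tdet_neq0 T.
(* Coordinates of w in the basis B - A, C - A, by the rule of Cramer. *)
pose w1 := cross w (vC T - vA T) / tdet T.
pose w2 := cross (vB T - vA T) w / tdet T.
have wE : w = w1 *: (vB T - vA T) + w2 *: (vC T - vA T).
  move: d0; rewrite /w1 /w2 /tdet /cross /= => d0.
  rewrite {1}(surjective_pairing w).
  by congr pair; rewrite /= /GRing.scale/=; field.
have E2 := integral_derive_AB (flip T) cf; rewrite domain_flip /= in E2.
have E1 := integral_derive_AB T cf.
transitivity (\int[leb2 R]_(p in domain T)
    (w1 * 'D_(vB T - vA T) f p + w2 * 'D_(vC T - vA T) f p)).
  apply: eq_Rintegral => p _; rewrite !deriveE; [|exact: cf.1..].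
  by rewrite {1}wE linearD !linearZ.
have iD v : (leb2 R).-integrable (domain T) (EFin \o (fun p => 'D_v f p)).
  by apply: integrable_domain; exact: C1_continuous_derive.
have iZ v k : (leb2 R).-integrable (domain T) (EFin \o (fun p => k * 'D_v f p)).
  apply: integrable_domain => p; apply: cvgM; first exact: cvg_cst.
  exact: C1_continuous_derive.
rewrite RintegralD//; last exact: measurable_domain.
rewrite !RintegralZl//; try exact: measurable_domain.
rewrite E1 E2.
have -> : tdet (flip T) = - tdet T by rewrite /tdet /cross /=; ring.
rewrite normrN /edges !big_cons big_nil /flux /=.
rewrite (edge_integral_rev (vC T) (vB T) cf0)//.
rewrite (edge_integral_rev (vA T) (vB T))//.
rewrite [`|tdet T|]normrEsg /w1 /w2.
have -> : cross w (vC T - vB T) = cross w (vC T - vA T) + cross (vB T - vA T) w.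
  by rewrite /cross /=; ring.
have -> : cross w (vB T - vA T) = - cross (vB T - vA T) w.
  by rewrite /cross /=; ring.
have -> : cross w (vA T - vC T) = - cross w (vC T - vA T).
  by rewrite /cross /=; ring.
move: (edge_integral _ f) (edge_integral _ f) (edge_integral _ f).
move: (cross w _) (cross _ w) => k1 k2 s1 s2 s3.
by field.
Qed.

End divergence.

(** * Smooth functions on the plane *)

Section smooth_functions.
Context {R : realType}.
Implicit Types (f g v : R * R -> R).

Lemma differentiable_affine (k l m : R) (p : R * R) :
  differentiable (fun q : R * R => k * q.1 + l * q.2 + m) p.
Proof.
have df : differentiable (fst : R * R -> R) p.
  by apply: (@linear_differentiable R (R * R)%type R fst) => q; exact: cvg_fst.
have ds : differentiable (snd : R * R -> R) p.
  by apply: (@linear_differentiable R (R * R)%type R snd) => q; exact: cvg_snd.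
apply: (@differentiableD _ _ _ (fun q : R * R => k * q.1 + l * q.2) (cst m))
  => //.
apply: (@differentiableD _ _ _ (fun q : R * R => k * q.1)
  (fun q : R * R => l * q.2)).
  exact: (differentiableZ k df).
exact: (differentiableZ l ds).
Qed.

(** Coinduction: smoothness is the largest property of differentiable functions
    that is stable under partial derivatives. *)
Lemma smooth_ind (P : (R * R -> R) -> Prop) :
  (forall f, P f -> (forall p, differentiable f p) /\ forall i, P (partial i f)) ->
  forall f, P f -> smooth f.
Proof.
move=> PP f Pf s p; suff : P (foldr (@partial R) f s) by move=> /PP[].
by elim: s => //= i s /PP[].
Qed.

Lemma smooth_partial f i : smooth f -> smooth (partial i f).
Proof. by move=> sf s p; have := sf (rcons s i) p; rewrite foldr_rcons. Qed.

Lemma smooth_C1 f : smooth f -> C1 f.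
Proof.
move=> sf; split => [|i p]; first exact: (sf [::]).
by apply: differentiable_continuous; exact: (sf [:: i]).
Qed.

Lemma smooth_continuous f : smooth f -> continuous f.
Proof. by move=> /smooth_C1/C1_continuous. Qed.


Lemma is_derive_affine1 (c d x : R) : is_derive x 1 (fun s : R => c + d * s) d.
Proof.
have D := is_deriveD (is_derive_cst c x 1) (is_deriveZ d (is_derive_id x 1)).
by apply: (is_derive_eq D); rewrite add0r /GRing.scale/= mulr1.
Qed.

Lemma derive_affine (k l m : R) (p w : R * R) :
  'D_w (fun q : R * R => k * q.1 + l * q.2 + m) p = k * w.1 + l * w.2.
Proof.
have [_] := derive_along (fun q : R * R => k * q.1 + l * q.2 + m) p w 0.
rewrite scale0r addr0 => <-.
rewrite (_ : (fun s : R => _) =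
    fun s => (k * p.1 + l * p.2 + m) + (k * w.1 + l * w.2) * s); last first.
  by apply/funext => s; rewrite /= /GRing.scale/=; ring.
by have /@derive_val :=
  is_derive_affine1 (k * p.1 + l * p.2 + m) (k * w.1 + l * w.2) 0.
Qed.

Definition exp_dot (w : R * R) (p : R * R) : R := expR (w.1 * p.1 + w.2 * p.2).

Lemma differentiable_exp_dot w p : differentiable (exp_dot w) p.
Proof.
rewrite (_ : exp_dot w = expR \o (fun q => w.1 * q.1 + w.2 * q.2 + 0)); last first.
  by apply/funext => q; rewrite /exp_dot /= addr0.
apply: differentiable_comp; first exact: differentiable_affine.
by apply/derivable1_diffP; exact: derivable_expR.
Qed.

Lemma derive_exp_dot (w v p : R * R) :
  'D_v (exp_dot w) p = (w.1 * v.1 + w.2 * v.2) * exp_dot w p.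
Proof.
have [_] := derive_along (exp_dot w) p v 0; rewrite scale0r addr0 => <-.
set d := w.1 * v.1 + w.2 * v.2; set c := w.1 * p.1 + w.2 * p.2.
rewrite (_ : (fun s : R => _) = expR \o (fun s : R => c + d * s)); last first.
  apply/funext => s; rewrite /exp_dot /=; congr expR.
  by rewrite /= /GRing.scale/= /c /d; ring.
have := @is_derive1_comp _ expR _ 0 _ _ (is_derive_expR _) (is_derive_affine1 c d 0).
by move=> /@derive_val ->; rewrite mulr0 addr0 mulrC.
Qed.

Lemma smooth_exp_dot w : smooth (exp_dot w).
Proof.
apply: (@smooth_ind (fun f => exists c : R, f = c \*o exp_dot w)); last first.
  by exists 1; apply/funext => p /=; rewrite mul1r.
move=> _ [c ->]; split => [p|i].
  exact: (differentiableZ c (differentiable_exp_dot w p)).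
exists (c * (w.1 * (basis2 R i).1 + w.2 * (basis2 R i).2)); apply/funext => p.
rewrite /partial deriveMl ?derive_exp_dot ?mulrA//.
exact: diff_derivable (differentiable_exp_dot _ _).
Qed.

(** The partial derivatives of f \o L are linear combinations of compositions
    with L; closing the compositions under linear combinations yields a family
    to which [smooth_ind] applies. *)
Inductive affine_comb (L : R * R -> R * R) : (R * R -> R) -> Prop :=
| comb_comp f : smooth f -> affine_comb L (f \o L)
| comb_lin a b f g : affine_comb L f -> affine_comb L g ->
    affine_comb L (fun p => a * f p + b * g p).

Definition affine2 (k1 l1 m1 k2 l2 m2 : R) (p : R * R) : R * R :=
  (k1 * p.1 + l1 * p.2 + m1, k2 * p.1 + l2 * p.2 + m2).

Section affine_comp.
Variables (k1 l1 m1 k2 l2 m2 : R).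
Notation L := (affine2 k1 l1 m1 k2 l2 m2).

Lemma derive_comp_affine f p w :
  'D_w (f \o L) p = 'D_(k1 * w.1 + l1 * w.2, k2 * w.1 + l2 * w.2) f (L p).
Proof.
rewrite /derive.
set u := (k1 * _ + _, _).
suff -> : (fun h : R => h^-1 *: (((f \o L) \o shift p) (h *: w) - (f \o L) p)) =
  (fun h => h^-1 *: ((f \o shift (L p)) (h *: u) - f (L p))) by [].
apply/funext => h /=; congr (_ *: (f _ - _)).
by rewrite /affine2 /u; congr pair; rewrite /= /GRing.scale/=; ring.
Qed.

Lemma differentiable_comp_affine f p :
  differentiable f (L p) -> differentiable (f \o L) p.
Proof.
move=> df; apply: differentiable_comp => //.
by apply: differentiable_pair; exact: differentiable_affine.
Qed.

Lemma smooth_comp_affine f : smooth f -> smooth (f \o L).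
Proof.
move=> sf; apply: (@smooth_ind (affine_comb L)); last exact: comb_comp.
move=> h; elim=> [{sf} {}f sf|a b f1 f2 _ [d1 c1] _ [d2 c2]]; split.
- by move=> p; apply: differentiable_comp_affine; exact: (sf [::]).
- move=> i; set e := basis2 R i.
  rewrite (_ : partial i _ = fun p =>
      (k1 * e.1 + l1 * e.2) * (partial false f \o L) p
    + (k2 * e.1 + l2 * e.2) * (partial true f \o L) p).
    by apply: comb_lin; apply: comb_comp; exact: smooth_partial.
  apply/funext => p; rewrite /partial derive_comp_affine derive_partial//.
  exact: (sf [::]).
- move=> p; apply: (@differentiableD _ _ _ (a \*: f1) (b \*: f2));
  exact: differentiableZ.
- move=> i.
  rewrite (_ : partial i _ = fun p => a * partial i f1 p + b * partial i f2 p).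
    exact: comb_lin.
  apply/funext => p; rewrite /partial (@deriveD _ _ _ (a \*: f1) (b \*: f2)).
  + by rewrite !deriveZ//; exact: diff_derivable.
  + by apply: diff_derivable; exact: differentiableZ.
  + by apply: diff_derivable; exact: differentiableZ.
Qed.
End affine_comp.

End smooth_functions.

(** * Convergence of squared norms *)

Section L2_limits.
Context d (X : measurableType d) (R : realType).
Variables (m : {measure set X -> \bar R}) (D : set X).
Hypothesis mD : measurable D.
Implicit Types f g : X -> R.

Lemma L2_sub f g : L2 m D f -> L2 m D g -> L2 m D (fun x => f x - g x).
Proof.
move=> [mf if2] [mg ig2]; split; first exact: measurable_funB.
apply: (@le_integrable _ _ _ m D mD _
  (fun x => (2%:E * (f x ^+ 2)%:E + 2%:E * (g x ^+ 2)%:E)%E)).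
- by apply/measurable_EFinP; apply: measurable_funX; exact: measurable_funB.
- move=> x _; rewrite -!EFinM -EFinD !abse_EFin lee_fin !ger0_norm ?sqr_ge0//.
    by have := sqr_ge0 (f x + g x); nra.
  by rewrite addr_ge0// mulr_ge0// sqr_ge0.
- by apply: integrableD => //; exact: integrableZl.
Qed.

(** With y = v n - f, the inequality 2 |f y| <= k f^2 + y^2 / k bounds the
    difference of the squared norms by k int f^2 + (1 + 1/k) int y^2, where k is
    chosen first to make the first term small. *)
Lemma L2_cvg (v : nat -> X -> R) f : (forall n, L2 m D (v n)) -> L2 m D f ->
  \int[m]_(x in D) (v n x - f x) ^+ 2 @[n --> \oo] --> (0 : R) ->
  \int[m]_(x in D) (v n x) ^+ 2 @[n --> \oo] --> \int[m]_(x in D) (f x) ^+ 2.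
Proof.
move=> L2v L2f cv; apply/cvgrPdist_le => e e0.
set a := \int[m]_(x in D) (f x) ^+ 2.
have a0 : 0 <= a by apply: Rintegral_ge0 => x _; exact: sqr_ge0.
(* a may vanish, hence the 1 *)
pose k := e / 2 / (a + 1).
have k0 : 0 < k by rewrite !divr_gt0// ltr_wpDl.
have ka : k * a <= e / 2.
  rewrite /k -mulrA (mulrC _ a) ler_piMr ?divr_ge0 ?(ltW e0)//.
  by rewrite ler_pdivrMr; lra.
have j0 : 0 < 1 + k^-1 by rewrite addr_gt0// invr_gt0.
near=> n.
have dn : (1 + k^-1) * \int[m]_(x in D) (v n x - f x) ^+ 2 <= e / 2.
  rewrite mulrC -ler_pdivlMr//.
  rewrite (le_trans (ler_norm _))//; near: n.
  by apply: (cvgr0_norm_le _ cv); rewrite !divr_gt0.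
have if2 := L2f.2; have iv2 := (L2v n).2; have id2 := (L2_sub (L2v n) L2f).2.
have iZ c g : m.-integrable D (fun x => (g x ^+ 2)%:E) ->
    m.-integrable D (EFin \o (fun x => c * g x ^+ 2)).
  by move=> ig; apply: (integrableZl _ c ig).
have kV : k * k^-1 = 1 by rewrite divff// gt_eqF.
have pw (x y : R) : k * (2 * x * y) <= k * (k * x ^+ 2 + k^-1 * y ^+ 2).
  by rewrite mulrDr [k * (k^-1 * _)]mulrA kV; have := sqr_ge0 (k * x - y); nra.
have up : \int[m]_(x in D) (v n x) ^+ 2 <=
    (1 + k) * a + (1 + k^-1) * \int[m]_(x in D) (v n x - f x) ^+ 2.
  rewrite /a -!RintegralZl// -RintegralD//; [|exact: iZ..].
  apply: le_Rintegral => //.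
    exact: (integrableD mD (iZ _ _ if2) (iZ _ _ id2)).
  move=> x _; have := pw (f x) (v n x - f x); rewrite ler_pM2l//; nra.
have dw : (1 - k) * a <= \int[m]_(x in D) (v n x) ^+ 2
    + (k^-1 - 1) * \int[m]_(x in D) (v n x - f x) ^+ 2.
  rewrite /a -!RintegralZl// -RintegralD//; [|exact: iZ..].
  apply: le_Rintegral => //; first exact: iZ.
    exact: (integrableD mD iv2 (iZ _ _ id2)).
  move=> x _; have := pw (f x) (- (v n x - f x)); rewrite ler_pM2l//; nra.
have d0 : 0 <= \int[m]_(x in D) (v n x - f x) ^+ 2.
  by apply: Rintegral_ge0 => x _; exact: sqr_ge0.
rewrite ler_norml; apply/andP; split; nra.
Unshelve. all: by end_near. Qed.

End L2_limits.

(** * Smooth functions compute the lowest eigenvalue *)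

Section variational.
Context {R : realType}.
Notation mu := (@lebesgue_measure R).
Implicit Types (T : triangle R) (v : R * R -> R).

(** In the chart, a boundary point violates one of the three strict inequalities
    that define the reference triangle. *)
Lemma edge_notin_domain T e s : e \in edges T -> ~ domain T (edge_point e s).
Proof.
have E p q : chart T p = q -> domain T q -> ref_triangle p.
  by move=> <- /domain_chart.
rewrite !inE => /or3P[] /eqP -> /=.
- move=> /(E (s, 0))[]; last by rewrite ltxx.
  by rewrite /chart /edge_point; congr pair; rewrite /= /GRing.scale/=; ring.
- move=> /(E (1 - s, s))[]; last by rewrite subrK ltxx.
  by rewrite /chart /edge_point; congr pair; rewrite /= /GRing.scale/=; ring.
- move=> /(E (0, 1 - s))[]; last by rewrite ltxx.
  by rewrite /chart /edge_point; congr pair; rewrite /= /GRing.scale/=; ring.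
Qed.

Lemma C1M (f g : R * R -> R) : C1 f -> C1 g -> C1 (fun p => f p * g p).
Proof.
move=> cf cg; have [df cdf] := cf; have [dg cdg] := cg; split => [p|i].
  exact: differentiableM.
rewrite (_ : partial i _ = fun p => f p * partial i g p + g p * partial i f p).
  by move=> p; apply: cvgD; apply: cvgM;
    [exact: C1_continuous|exact: cdg|exact: C1_continuous|exact: cdf].
by apply/funext => p; rewrite /partial (@deriveM _ _ f g)//; exact: diff_derivable.
Qed.

Lemma partialM (f g : R * R -> R) i p : C1 f -> C1 g ->
  partial i (fun p => f p * g p) p = f p * partial i g p + g p * partial i f p.
Proof.
by move=> [df _] [dg _]; rewrite /partial (@deriveM _ _ f g)//; exact: diff_derivable.
Qed.

(** Integration by parts is the divergence theorem for the product of v with the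
    test function, whose boundary terms vanish because the test function is
    supported in the open triangle. *)
Lemma weak_partial_C1 T i v : C1 v -> weak_partial (domain T) i v (partial i v).
Proof.
move=> cv phi [sphi _ supp].
have cphi := smooth_C1 sphi.
have [c0v c0phi] := (C1_continuous cv, C1_continuous cphi).
have phi0 e s : e \in edges T -> phi (edge_point e s) = 0.
  move=> eT; apply/eqP/negPn/negP => p0.
  by apply: (@edge_notin_domain T e s eT); apply: supp; exact: subset_closure.
have := divergence_triangle T (basis2 R i) (C1M cv cphi).
rewrite [RHS]big1_seq; last first.
  move=> e /= eT.
  rewrite /edge_integral (@eq_Rintegral _ _ _ _ _ (fun=> 0)); last first.
    by move=> s _; rewrite phi0 ?mulr0.
  by rewrite /Rintegral integral0 mulr0.
rewrite (@eq_Rintegral _ _ _ (leb2 R) _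
    (fun p => v p * partial i phi p + partial i v p * phi p)); last first.
  move=> p _; rewrite -/(partial i (fun p => v p * phi p) p) partialM//.
  by rewrite [in X in _ + X]mulrC.
rewrite RintegralD; last 3 first.
- exact: measurable_domain.
- by apply: integrable_domain => p; apply: cvgM; [exact: c0v|exact: cphi.2].
- by apply: integrable_domain => p; apply: cvgM; [exact: cv.2|exact: c0phi].
by move=> /eqP; rewrite addr_eq0 => /eqP.
Qed.

Lemma continuous_sqr (X : topologicalType) (f : X -> R) :
  continuous f -> continuous (fun x => f x ^+ 2).
Proof. by move=> cf x; exact: (cvgM (cf x) (cf x)). Qed.

Lemma L2_domain T f : continuous f -> L2 (leb2 R) (domain T) f.
Proof.
move=> cf; split; first by apply: measurable_funTS; exact: continuous_measurable_fun2.
by apply: (@integrable_domain _ T (fun p => f p ^+ 2)); exact: continuous_sqr.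
Qed.

Lemma L2_edge e f : continuous f -> L2 mu `[0, 1] (f \o edge_point e).
Proof.
move=> cf; have cfe := continuous_edge (e := e) cf; split.
  by apply: measurable_funTS; exact: continuous_measurable_fun.
by apply: (@integrable01 _ (fun s => f (edge_point e s) ^+ 2)); exact: continuous_sqr.
Qed.

Lemma C1_H1 T v : C1 v -> H1 (domain T) v (fun i => partial i v).
Proof.
move=> cv; split; first by apply: L2_domain; exact: C1_continuous.
  by move=> i; apply: L2_domain; exact: cv.2.
by move=> i; exact: weak_partial_C1.
Qed.

Lemma smooth_trace T v : smooth v -> is_trace T v (fun i => partial i v) v.
Proof.
move=> sv; split; first by move=> e _; apply: L2_edge; exact: smooth_continuous.
exists (fun=> v); split => //.
- rewrite (_ : (fun _ => _) = fun=> 0%E); first exact: cvg_cst.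
  by apply/funext => n; apply: integral0_eq => p _; rewrite subrr expr0n.
- move=> i; rewrite (_ : (fun _ => _) = fun=> 0%E); first exact: cvg_cst.
  by apply/funext => n; apply: integral0_eq => p _; rewrite subrr expr0n.
- rewrite (_ : (fun _ => _) = fun=> 0); first exact: cvg_cst.
  apply/funext => n; rewrite /bd_integral big1// => e _.
  rewrite (@eq_Rintegral _ _ _ _ _ (fun=> 0)); last first.
    by move=> s _; rewrite subrr expr0n.
  by rewrite /Rintegral integral0 mulr0.
Qed.

Definition energy T v : R :=
  \int[leb2 R]_(p in domain T) (partial false v p ^+ 2 + partial true v p ^+ 2).
Definition mass T v : R := \int[leb2 R]_(p in domain T) (v p ^+ 2).
Definition bdmass T v : R := bd_integral T (fun p => v p ^+ 2).

Lemma lambda1_le_smooth alpha T v : smooth v -> 0 < mass T v ->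
  (lambda1 alpha T <= ((energy T v + alpha * bdmass T v) / mass T v)%:E)%E.
Proof.
move=> sv m0; apply: ereal_inf_lbound.
exists v, (fun i => partial i v), v; split => //.
- exact: C1_H1 (smooth_C1 sv).
- move=> v0; move: m0; rewrite lt_neqAle => /andP[/eqP + _]; apply; apply/esym.
  have cv := smooth_continuous sv.
  rewrite /mass /Rintegral (@ae_eq_integral _ _ _ _ _ (cst 0%E)).
  + by rewrite integral0.
  + exact: measurable_domain.
  + apply/measurable_EFinP/measurable_funX/measurable_funTS.
    exact: continuous_measurable_fun2.
  + exact: measurable_cst.
  + have FF := @ae_filter_ringOfSetsType _ _ _ (leb2 R).
    by apply: (@filterS _ _ FF) v0 => p h Dp; rewrite h// expr0n.
- exact: smooth_trace.
Qed.
End variational.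

Section lower_bound.
Context {R : realType}.
Notation mu := (@lebesgue_measure R).
Notation R2 := (measurableTypeR R * measurableTypeR R)%type.
Implicit Types (T : triangle R) (v : R * R -> R).

Definition sqdist (p q : R * R) : R := (p.1 - q.1) ^+ 2 + (p.2 - q.2) ^+ 2.

Lemma edge_length_gt0 T e : e \in edges T -> 0 < dist2 e.1 e.2.
Proof.
have d0 := tdet_neq0 T; rewrite /tdet /cross /= in d0.
move=> eT; rewrite /dist2 sqrtr_gt0 lt_neqAle addr_ge0 ?sqr_ge0// andbT eq_sym.
rewrite paddr_eq0 ?sqr_ge0// !sqrf_eq0 !subr_eq0.
apply/negP => /andP[/eqP + /eqP +]; move: eT; rewrite !inE.
move=> /or3P[] /eqP -> /= E1 E2;
  by case/negP: d0; apply/eqP; rewrite ?E1 ?E2; ring.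
Qed.

Lemma edge_sum T (F : (R * R) * (R * R) -> R) :
  \sum_(e <- edges T) F e = F (vA T, vB T) + (F (vB T, vC T) + F (vC T, vA T)).
Proof. by rewrite !big_cons big_nil addr0. Qed.

Lemma edge_le_sum T (F : (R * R) * (R * R) -> R) e : (forall e', 0 <= F e') ->
  e \in edges T -> F e <= \sum_(e' <- edges T) F e'.
Proof.
move=> F0; rewrite edge_sum.
have := F0 (vA T, vB T); have := F0 (vB T, vC T); have := F0 (vC T, vA T).
by rewrite !inE => ? ? ? /or3P[] /eqP ->; lra.
Qed.

Lemma edge_le_bd_integral T f e : (forall p, 0 <= f p) -> e \in edges T ->
  dist2 e.1 e.2 * edge_integral e f <= bd_integral T f.
Proof.
move=> f0.
apply: (edge_le_sum (F := fun e => dist2 e.1 e.2 * edge_integral e f)) => e'.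
by rewrite mulr_ge0 ?sqrtr_ge0//; apply: Rintegral_ge0 => s _; exact: f0.
Qed.

Lemma bd_L2_cvg T (v : nat -> R * R -> R) t :
  (forall n, continuous (v n)) -> bd_L2 T t ->
  bd_integral T (fun p => (v n p - t p) ^+ 2) @[n --> \oo] --> (0 : R) ->
  bdmass T (v n) @[n --> \oo] --> bd_integral T (fun p => t p ^+ 2).
Proof.
move=> cv L2t c0.
have ce e : e \in edges T ->
    dist2 e.1 e.2 * edge_integral e (fun p => v n p ^+ 2) @[n --> \oo]
    --> dist2 e.1 e.2 * edge_integral e (fun p => t p ^+ 2).
  move=> eT; apply: cvgM; first exact: cvg_cst.
  apply: (@L2_cvg _ _ _ mu `[0, 1]%classic _ (fun n => v n \o edge_point e)
    (t \o edge_point e)) => //.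
  - by move=> n; exact: L2_edge.
  - exact: L2t.
  - have l0 := edge_length_gt0 eT.
    apply: (@squeeze_cvgr _ _ _ _ (fun=> 0) (fun n =>
      (dist2 e.1 e.2)^-1 * bd_integral T (fun p => (v n p - t p) ^+ 2))).
    + near=> n; apply/andP; split.
        by apply: Rintegral_ge0 => s _; exact: sqr_ge0.
      rewrite mulrC ler_pdivlMr// mulrC.
      apply: (edge_le_bd_integral (f := fun p => (v n p - t p) ^+ 2)) => // p.
      exact: sqr_ge0.
    + exact: cvg_cst.
    + rewrite -[X in _ --> X](mulr0 (dist2 e.1 e.2)^-1); apply: cvgM => //.
      exact: cvg_cst.
have bdE h : bd_integral T h = dist2 (vA T) (vB T) * edge_integral (vA T, vB T) h +
    (dist2 (vB T) (vC T) * edge_integral (vB T, vC T) h +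
     dist2 (vC T) (vA T) * edge_integral (vC T, vA T) h) by exact: edge_sum.
rewrite bdE (_ : (fun n => _) =
  fun n => dist2 (vA T) (vB T) * edge_integral (vA T, vB T) (fun p => v n p ^+ 2) +
    (dist2 (vB T) (vC T) * edge_integral (vB T, vC T) (fun p => v n p ^+ 2) +
     dist2 (vC T) (vA T) * edge_integral (vC T, vA T) (fun p => v n p ^+ 2)));
  last first.
  by apply/funext => n; exact: bdE.
apply: cvgD; first by apply: (ce (vA T, vB T)); rewrite !inE eqxx.
apply: cvgD; first by apply: (ce (vB T, vC T)); rewrite !inE eqxx orbT.
by apply: (ce (vC T, vA T)); rewrite !inE eqxx !orbT.
Unshelve. all: by end_near. Qed.

Lemma L2_norm_gt0 T u : L2 (leb2 R) (domain T) u ->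
  ~ {ae leb2 R, forall p, domain T p -> u p = 0} ->
  0 < \int[leb2 R]_(p in domain T) (u p ^+ 2).
Proof.
move=> [mu_ iu] nz; rewrite lt_neqAle Rintegral_ge0 ?andbT; last first.
  by move=> p _; exact: sqr_ge0.
apply/negP => /eqP E; apply: nz.
have mD := measurable_domain T.
have I0 : (\int[leb2 R]_(p in domain T) `|(u p ^+ 2)%:E| = 0)%E.
  rewrite (eq_integral (fun p => (u p ^+ 2)%:E)); last first.
    by move=> p _; rewrite gee0_abs// lee_fin sqr_ge0.
  have := fineK (integrable_fin_num mD iu).
  by rewrite -[fine _]/(\int[leb2 R]_(p in domain T) (u p ^+ 2)) -E => <-.
have mu2 : measurable_fun (domain T : set R2) (fun p => (u p ^+ 2)%:E).
  by apply/measurable_EFinP/measurable_funX.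
have := (ae_eq_integral_abs (leb2 R) mD mu2).1 I0.
have FF := @ae_filter_ringOfSetsType _ _ _ (leb2 R).
apply: (@filterS _ _ FF) => p h Dp; have [] := h Dp.
by move=> /eqP; rewrite sqrf_eq0 => /eqP.
Qed.

(** The quotient of an admissible triple is the limit of the quotients of the
    smooth functions that define its trace: their L^2 norms, Dirichlet energies
    and boundary norms all converge, and the limit of the L^2 norms is
    nonzero. *)
Lemma lambda1_ge_smooth alpha T (x : \bar R) :
  (forall v, smooth v -> 0 < mass T v ->
    (x <= ((energy T v + alpha * bdmass T v) / mass T v)%:E)%E) ->
  (x <= lambda1 alpha T)%E.
Proof.
move=> H; apply/ereal_infP => q.
move=> [u [g [t [[L2u L2g _] nz [L2t [v [sv cu cg ct]]] ->]]]].
have m0 := L2_norm_gt0 L2u nz.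
have mD := measurable_domain T.
have cv n := smooth_continuous (sv n).
have cmass : mass T (v n) @[n --> \oo] --> \int[leb2 R]_(p in domain T) (u p ^+ 2).
  apply: (@L2_cvg _ _ _ (leb2 R) (domain T) mD v u) => //.
    by move=> n; exact: L2_domain.
  exact: (fine_cvg cu).
have cgrad i :
    \int[leb2 R]_(p in domain T) (partial i (v n) p ^+ 2) @[n --> \oo] -->
    \int[leb2 R]_(p in domain T) (g i p ^+ 2).
  apply: (@L2_cvg _ _ _ (leb2 R) (domain T) mD (fun n => partial i (v n)) (g i))
    => //.
    by move=> n; apply: L2_domain; exact: (smooth_C1 (sv n)).2.
  exact: (fine_cvg (cg i)).
have cen : energy T (v n) @[n --> \oo] -->
    \int[leb2 R]_(p in domain T) (g false p ^+ 2 + g true p ^+ 2).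
  rewrite RintegralD//; [|exact: (L2g _).2..].
  rewrite (_ : (fun n => _) = fun n =>
      \int[leb2 R]_(p in domain T) (partial false (v n) p ^+ 2) +
      \int[leb2 R]_(p in domain T) (partial true (v n) p ^+ 2)).
    exact: cvgD.
  apply/funext => n; rewrite /energy RintegralD//;
   exact: (@L2_domain _ T _ ((smooth_C1 (sv n)).2 _)).2.
have cbd := bd_L2_cvg cv L2t ct.
have cq : (energy T (v n) + alpha * bdmass T (v n)) / mass T (v n) @[n --> \oo] -->
    robin_quotient alpha T u g t.
  apply: cvgM; last by apply: cvgV => //; rewrite gt_eqF.
  by apply: cvgD => //; apply: cvgM => //; exact: cvg_cst.
have evpos : \forall n \near \oo, 0 < mass T (v n) by exact: (cvgr_gt _ cmass).
case: x H => [r||] H.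
- rewrite lee_fin.
  apply: (@closed_cvg _ _ _ _ _ (fun y => r <= y) (@closed_ge _ r) _ _ cq).
  by apply: filterS evpos => n mn; have := H _ (sv n) mn; rewrite lee_fin.
- have [n /(H _ (sv n))] := filter_ex evpos.
  by rewrite leye_eq.
- exact: leNye.
Qed.
End lower_bound.

(** * Bounds by exponential test functions and by a radial field *)

Section bounds.
Context {R : realType}.
Notation mu := (@lebesgue_measure R).
Implicit Types (T : triangle R) (v : R * R -> R) (w p : R * R).

Lemma Rintegral01_cst (c : R) : \int[mu]_(y in `[0, 1]) c = c.
Proof.
have m01 : @lebesgue_measure R [set` `[0%R, 1%R]] = 1%E.
  by rewrite lebesgue_measure_itv/= lte_fin ltr01 -EFinB subr0.
by rewrite Rintegral_cst// [X in fine X]m01 mulr1.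
Qed.

(** The substitution y -> 1 - y shows that 1 - y and y have the same integral,
    and their sum integrates to 1. *)
Lemma Rintegral01_onem : \int[mu]_(y in `[0, 1]) (1 - y) = 2^-1 :> R.
Proof.
have cid : continuous (fun y : R => y) by move=> y; exact: cvg_id.
have c1B : continuous (fun y : R => 1 - y).
  by move=> z; apply: cvgB; [exact: cvg_cst|exact: cvg_id].
have E : \int[mu]_(y in `[0, 1]) (1 - y) = \int[mu]_(y in `[0, 1]) y :> R.
  rewrite [RHS]Rintegration_by_substitution_onem; last 2 first.
  - by rewrite ler01 lexx.
  - exact: continuous_subspaceT.
  by rewrite unstable.onem1.
have : \int[mu]_(y in `[0, 1]) (1 - y) + \int[mu]_(y in `[0, 1]) y = 1 :> R.
  rewrite -RintegralD//; [|exact: integrable01..].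
  rewrite -[RHS](Rintegral01_cst 1); apply: eq_Rintegral => y _.
  by rewrite subrK.
by rewrite -E; lra.
Qed.

Lemma Rintegral_domain_cst T (c : R) :
  \int[leb2 R]_(p in domain T) c = c * (`|tdet T| / 2).
Proof.
rewrite Rintegral_domain; last by move=> p; exact: cvg_cst.
rewrite (@integral_ref_dx _ (fun p => c * p.1 + 0 * p.2 + 0) (fun=> c)).
- rewrite (@eq_Rintegral _ _ _ mu _ (fun y => c * (1 - y))); last first.
    by move=> y _ /=; ring.
  rewrite RintegralZl//; last first.
    by apply: integrable01 => z; apply: cvgB; [exact: cvg_cst|exact: cvg_id].
  by rewrite Rintegral01_onem; ring.
- move=> x y.
  rewrite (_ : (fun z => _) = fun z : R => 0 + c * z); last first.
    by apply/funext => z /=; ring.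
  have D := is_derive_affine1 0 c x.
  by split; [exact: @ex_derive|exact: @derive_val].
- exact: continuous_affine.
- by move=> p; exact: cvg_cst.
Qed.

Lemma measure_domain T : leb2 R (domain T) = (`|tdet T| / 2)%:E.
Proof.
have := Rintegral_domain_cst T 1; rewrite mul1r Rintegral_cst; last first.
  exact: measurable_domain.
rewrite mul1r => <-; rewrite fineK// ge0_fin_numE//.
have [M DM] := bounded_domain T.
exact: (bounded_domain_measure_lty (measurable_domain T) DM).
Qed.

Definition dot (u w : R * R) : R := u.1 * w.1 + u.2 * w.2.

Lemma partial_exp_dot w i p :
  partial i (exp_dot w) p = (if i then w.2 else w.1) * exp_dot w p.
Proof.
by rewrite /partial derive_exp_dot; case: i => /=; rewrite mulr1 mulr0 ?addr0 ?add0r.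
Qed.

Lemma exp_dot_sqr w p : exp_dot w p ^+ 2 = exp_dot (2 *: w) p.
Proof.
by rewrite /exp_dot expr2 -expRD; congr expR; rewrite /= /GRing.scale/=; ring.
Qed.

Lemma mass_exp_dot_gt0 T w : 0 < mass T (exp_dot w).
Proof.
have [M DM] := bounded_domain T.
have cw := smooth_continuous (smooth_exp_dot (2 *: w)).
pose K := expR (- ((`|w.1| + `|w.2|) * M * 2)).
apply: (@lt_le_trans _ _ (\int[leb2 R]_(p in domain T) K)).
  by rewrite Rintegral_domain_cst mulr_gt0 ?expR_gt0// divr_gt0// normr_gt0 tdet_neq0.
apply: le_Rintegral.
- exact: measurable_domain.
- by apply: integrable_domain => p; exact: cvg_cst.
- rewrite (_ : (fun p => _) = exp_dot (2 *: w)); first exact: integrable_domain.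
  by apply/funext => p; rewrite exp_dot_sqr.
- move=> p /DM[p1 p2]; rewrite exp_dot_sqr ler_expR /=.
  have b (x y : R) : `|y| <= M -> - (`|x| * M) <= x * y.
    move=> yM; rewrite lerNl (le_trans _ (ler_wpM2l (normr_ge0 x) yM))//.
    by rewrite -normrM (le_trans (ler_norm _))// normrN.
  by have := b w.1 _ p1; have := b w.2 _ p2; rewrite /GRing.scale/=; lra.
Qed.

Lemma energy_exp_dot T w : energy T (exp_dot w) = dot w w * mass T (exp_dot w).
Proof.
rewrite /energy /mass -RintegralZl//; last 2 first.
- exact: measurable_domain.
- apply: integrable_domain; apply: continuous_sqr.
  exact/smooth_continuous/smooth_exp_dot.
by apply: eq_Rintegral => p _; rewrite !partial_exp_dot /dot; ring.
Qed.

(** By the divergence theorem for the field u^2 w, where u = exp (w . p) and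
    div (u^2 w) = 2 |w|^2 u^2, the boundary term t int_bd u^2 is at least twice
    the energy |w|^2 int u^2. *)
Lemma lambda1_le_exp_dot T (t : R) w : 0 <= t ->
  (forall e, e \in edges T -> flux T w e <= t * dist2 e.1 e.2) ->
  (lambda1 (- t) T <= (- dot w w)%:E)%E.
Proof.
move=> t0 fl; have m0 := mass_exp_dot_gt0 T w.
apply: (le_trans (lambda1_le_smooth _ (smooth_exp_dot w) m0)).
rewrite lee_fin ler_pdivrMr// energy_exp_dot.
suff : 2 * dot w w * mass T (exp_dot w) <= t * bdmass T (exp_dot w) by lra.
have cw := smooth_C1 (smooth_exp_dot (2 *: w)).
have := divergence_triangle T w cw.
rewrite (@eq_Rintegral _ _ _ (leb2 R) _
    (fun p => (2 * dot w w) * exp_dot w p ^+ 2)); last first.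
  by move=> p _; rewrite derive_exp_dot exp_dot_sqr /dot /= /GRing.scale/=; ring.
rewrite RintegralZl//; last 2 first.
- exact: measurable_domain.
- apply: integrable_domain; apply: continuous_sqr.
  exact/smooth_continuous/smooth_exp_dot.
move=> ->; rewrite /bdmass /bd_integral mulr_sumr.
rewrite big_seq [leRHS]big_seq; apply: ler_sum => e eT.
rewrite mulrA (_ : edge_integral e (exp_dot (2 *: w)) =
    \int[mu]_(s in `[0, 1]) exp_dot w (edge_point e s) ^+ 2); last first.
  by apply: eq_Rintegral => s _; rewrite exp_dot_sqr.
apply: ler_wpM2r; last exact: fl.
by apply: Rintegral_ge0 => s _; exact: sqr_ge0.
Qed.

Definition perimeter T : R := \sum_(e <- edges T) dist2 e.1 e.2.

(** The constant function 1 is [exp_dot 0], and the area is half of |tdet|. *)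
Lemma lambda1_le_cst T (alpha : R) :
  (lambda1 alpha T <= (alpha * (2 * perimeter T / `|tdet T|))%:E)%E.
Proof.
have m0 := mass_exp_dot_gt0 T 0.
apply: (le_trans (lambda1_le_smooth _ (smooth_exp_dot 0) m0)).
have e1 p : exp_dot 0 p ^+ 2 = 1 by rewrite /exp_dot /= !mul0r addr0 expR0 expr1n.
rewrite energy_exp_dot /dot /= !mul0r !addr0 mul0r add0r lee_fin.
have -> : mass T (exp_dot 0) = `|tdet T| / 2.
  rewrite -[RHS]mul1r -Rintegral_domain_cst.
  by apply: eq_Rintegral => p _; rewrite e1.
have -> : bdmass T (exp_dot 0) = perimeter T.
  apply: eq_bigr => e _; rewrite (@eq_Rintegral _ _ _ mu _ (fun=> 1)).
    by rewrite Rintegral01_cst mulr1.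
  by [].
rewrite le_eqVlt; apply/orP; left; apply/eqP.
by field; rewrite normr_eq0 tdet_neq0.
Qed.

(** With k = t / r, the field F(p) = k (p - I) satisfies F . n = t on every edge
    and div F = 2 k. Since
    div (v^2 F) = 2 v (grad v . F) + 2 k v^2 <= |grad v|^2 + (|F|^2 + 2 k) v^2,
    the divergence theorem bounds t int_bd v^2. *)
Lemma lambda1_ge_incircle T (t r rho2 : R) (I : R * R) : 0 <= t -> 0 < r ->
  (forall e, e \in edges T ->
    Num.sg (tdet T) * cross (e.1 - I) (e.2 - e.1) = r * dist2 e.1 e.2) ->
  (forall p, domain T p -> dot (p - I) (p - I) <= rho2 * r ^+ 2) ->
  ((- (t * (2 / r) + t ^+ 2 * rho2))%:E <= lambda1 (- t) T)%E.
Proof.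
move=> t0 r0 fl rad; apply: lambda1_ge_smooth => v sv m0.
have cv := smooth_C1 sv.
have cv0 := C1_continuous cv.
pose k := t / r.
(* l i is the i-th component of k (p - I), and F i that of v^2 k (p - I) *)
pose l i : R * R -> R := fun p =>
  k * ((if i then p.2 else p.1) - (if i then I.2 else I.1)).
pose F i p := (v p * v p) * l i p.
have lE i : l i = fun p => (if i then 0 else k) * p.1
    + (if i then k else 0) * p.2 + - k * (if i then I.2 else I.1).
  by apply/funext => p; rewrite /l; case: i; ring.
have dl i p : partial i (l i) p = k.
  by rewrite lE /partial derive_affine; case: i => /=; ring.
have cl i : C1 (l i).
  rewrite lE; split => [p|j]; first exact: differentiable_affine.
  rewrite (_ : partial j _ = cst ((if i then 0 else k) * (basis2 R j).1
      + (if i then k else 0) * (basis2 R j).2)).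
    by move=> p; exact: cvg_cst.
  by apply/funext => p; rewrite /partial derive_affine.
have cF i : C1 (F i) by apply: C1M (cl i); exact: C1M.
have dF i p : partial i (F i) p =
    2 * (v p * l i p) * partial i v p + k * v p ^+ 2.
  by rewrite /F partialM//; [rewrite partialM// dl; ring|exact: C1M].
have E i := divergence_triangle T (basis2 R i) (cF i).
have iF i : (leb2 R).-integrable (domain T) (EFin \o partial i (F i)).
  by apply: integrable_domain; exact: (cF i).2.
have iv2 : (leb2 R).-integrable (domain T) (EFin \o (fun p => v p ^+ 2)).
  by apply: integrable_domain; exact: continuous_sqr.
have ien : (leb2 R).-integrable (domain T)
    (EFin \o (fun p => partial false v p ^+ 2 + partial true v p ^+ 2)).
  apply: integrable_domain => p; apply: cvgD; apply: continuous_sqr;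
  exact: cv.2.
have key : t * bdmass T v <=
    energy T v + (t * (2 / r) + t ^+ 2 * rho2) * mass T v.
  have mD := measurable_domain T.
  apply: (@le_trans _ _ (\int[leb2 R]_(p in domain T)
      (partial false (F false) p + partial true (F true) p))).
    rewrite RintegralD// (E false) (E true) -big_split/=.
    rewrite /bdmass /bd_integral mulr_sumr.
    rewrite le_eqVlt; apply/orP; left; apply/eqP.
    rewrite big_seq [RHS]big_seq; apply: eq_bigr => e eT.
    have ie i : mu.-integrable `[0, 1] (EFin \o (fun s => F i (edge_point e s))).
      by apply: integrable01; apply: continuous_edge; exact: C1_continuous.
    have iv : mu.-integrable `[0, 1] (EFin \o (fun s => v (edge_point e s) ^+ 2)).
      by apply: integrable01; apply: continuous_sqr; exact: continuous_edge.
    rewrite /edge_integral -!RintegralZl//.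
    rewrite -RintegralD//; last 2 first.
    + apply: integrable01 => s; apply: cvgM; first exact: cvg_cst.
      by apply: continuous_edge; exact: C1_continuous.
    + apply: integrable01 => s; apply: cvgM; first exact: cvg_cst.
      by apply: continuous_edge; exact: C1_continuous.
    apply: eq_Rintegral => s _; rewrite mulrA.
    have -> : t * dist2 e.1 e.2 =
        k * (Num.sg (tdet T) * cross (e.1 - I) (e.2 - e.1)).
      by rewrite (fl e eT) /k; field; rewrite gt_eqF.
    (* cross (p - I) (e.2 - e.1) is constant for p on the line through e *)
    by rewrite /flux /cross /F /l /edge_point /= /GRing.scale/=; ring.
    apply: integrable01 => s; apply: cvgM; first exact: cvg_cst.
    by apply: continuous_sqr; exact: continuous_edge.
  rewrite /energy /mass -RintegralZl// -RintegralD//; last first.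
    apply: integrable_domain => p; apply: cvgM; first exact: cvg_cst.
    exact: continuous_sqr.
  apply: le_Rintegral => //.
    apply: integrable_domain => p; apply: cvgD; exact: (cF _).2.
    apply: integrable_domain => p; apply: cvgD.
      by apply: cvgD; apply: continuous_sqr; exact: cv.2.
    by apply: cvgM; [exact: cvg_cst|exact: continuous_sqr].
  move=> p Dp; rewrite !dF.
  have -> : t * (2 / r) + t ^+ 2 * rho2 = 2 * k + k ^+ 2 * (rho2 * r ^+ 2).
    by rewrite /k; field; rewrite gt_eqF.
  have h1 := sqr_ge0 (partial false v p - v p * l false p).
  have h2 := sqr_ge0 (partial true v p - v p * l true p).
  have h3 : l false p ^+ 2 + l true p ^+ 2 <= k ^+ 2 * (rho2 * r ^+ 2).
    have -> : l false p ^+ 2 + l true p ^+ 2 = k ^+ 2 * dot (p - I) (p - I).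
      by rewrite /l /dot /=; ring.
    by rewrite ler_wpM2l ?sqr_ge0//; exact: rad.
  have h4 := ler_wpM2r (sqr_ge0 (v p)) h3.
  by lra.
rewrite lee_fin ler_pdivlMr//; lra.
Qed.

End bounds.

(** * Invariance under congruence *)

Section congruence.
Context {R : realType}.
Notation mu := (@lebesgue_measure R).
Implicit Types (T : triangle R) (v : R * R -> R) (w p : R * R).

Lemma dist2_sqr (p q : R * R) : dist2 p q ^+ 2 = sqdist p q.
Proof. by rewrite /dist2 sqr_sqrtr// addr_ge0 ?sqr_ge0. Qed.

Section transport.
Variables T T' : triangle R.
Hypotheses (eAB : dist2 (vA T) (vB T) = dist2 (vA T') (vB T'))
  (eBC : dist2 (vB T) (vC T) = dist2 (vB T') (vC T'))
  (eCA : dist2 (vC T) (vA T) = dist2 (vC T') (vA T')).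

Let u := vB T - vA T.
Let w := vC T - vA T.
Let u' := vB T' - vA T'.
Let w' := vC T' - vA T'.

(* The matrix (k1 l1 ; k2 l2) maps u to u' and w to w'. *)
Let k1 := (u'.1 * w.2 - w'.1 * u.2) / tdet T.
Let l1 := (w'.1 * u.1 - u'.1 * w.1) / tdet T.
Let k2 := (u'.2 * w.2 - w'.2 * u.2) / tdet T.
Let l2 := (w'.2 * u.1 - u'.2 * w.1) / tdet T.
Let phi := affine2 k1 l1 ((vA T').1 - k1 * (vA T).1 - l1 * (vA T).2)
                   k2 l2 ((vA T').2 - k2 * (vA T).1 - l2 * (vA T).2).

Let phi_chart p : phi (chart T p) = chart T' p.
Proof.
have := tdet_neq0 T.
rewrite /phi /affine2 /chart /k1 /l1 /k2 /l2 /tdet /cross /u /w /u' /w' /= => h.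
by congr pair; field.
Qed.

Let gram : [/\ dot u u = dot u' u', dot w w = dot w' w' & dot u w = dot u' w'].
Proof.
have := congr1 (fun x => x ^+ 2) eAB; have := congr1 (fun x => x ^+ 2) eBC.
have := congr1 (fun x => x ^+ 2) eCA.
rewrite !dist2_sqr /sqdist /dot /u /w /u' /w' /= => E1 E2 E3.
by split; nra.
Qed.

Let tdet_sqr : tdet T ^+ 2 = tdet T' ^+ 2.
Proof.
have [E1 E2 E3] := gram.
have -> : tdet T ^+ 2 = dot u u * dot w w - dot u w ^+ 2.
  by rewrite /tdet /cross /dot -/u -/w; ring.
by rewrite E1 E2 E3 /tdet /cross /dot -/u' -/w'; ring.
Qed.

Let tdet_norm : `|tdet T| = `|tdet T'|.
Proof. by rewrite -sqrtr_sqr tdet_sqr sqrtr_sqr. Qed.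

(** The rows of the matrix are orthonormal: it maps one basis of the plane to
    another one with the same Gram matrix. *)
Let orth : [/\ k1 ^+ 2 + l1 ^+ 2 = 1, k2 ^+ 2 + l2 ^+ 2 = 1 & k1 * k2 + l1 * l2 = 0].
Proof.
have [E1 E2 E3] := gram; have d0 := tdet_neq0 T.
have E : tdet T' ^+ 2 = cross u' w' ^+ 2 by [].
rewrite /k1 /l1 /k2 /l2 !expr_div_n -!mulrDl tdet_sqr.
have d0' := tdet_neq0 T'.
have e (a b : R) : (a * w.2 - b * u.2) ^+ 2 + (b * u.1 - a * w.1) ^+ 2 =
    a ^+ 2 * dot w w - 2 * a * b * dot u w + b ^+ 2 * dot u u.
  by rewrite /dot; ring.
rewrite !e E1 E2 E3 E; split.
- rewrite (_ : _ - _ + _ = cross u' w' ^+ 2) ?divff ?sqrf_eq0//.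
  by rewrite /cross /dot; ring.
- rewrite (_ : _ - _ + _ = cross u' w' ^+ 2) ?divff ?sqrf_eq0//.
  by rewrite /cross /dot; ring.
- rewrite (_ : _ + _ = (u'.1 * u'.2 * dot w w
    - (u'.1 * w'.2 + w'.1 * u'.2) * dot u w
    + w'.1 * w'.2 * dot u u) / tdet T ^+ 2); last by rewrite /dot; field.
  by rewrite E1 E2 E3 /dot; field.
Qed.

Let phi_edge (f : R * R -> R) : bd_integral T (f \o phi) = bd_integral T' f.
Proof.
(* an edge is the image under the chart of the path (a s + b, c s + d), the same
   one for both triangles *)
have E X Y X' Y' a b c d : dist2 X Y = dist2 X' Y' ->
    (forall s, edge_point (X, Y) s = chart T (a * s + b, c * s + d)) ->
    (forall s, edge_point (X', Y') s = chart T' (a * s + b, c * s + d)) ->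
    dist2 X Y * \int[mu]_(s in `[0, 1]) (f \o phi) (edge_point (X, Y) s) =
    dist2 X' Y' * \int[mu]_(s in `[0, 1]) f (edge_point (X', Y') s).
  move=> -> E1 E2; congr *%R; apply: eq_Rintegral => s _ /=.
  by rewrite E1 E2 phi_chart.
rewrite /bd_integral /edges !big_cons !big_nil /=.
congr (_ + (_ + (_ + _))).
- apply: (E _ _ _ _ 1 0 0 0) => // s; rewrite /chart /edge_point;
  by congr pair; rewrite /= /GRing.scale/=; ring.
- apply: (E _ _ _ _ (-1) 1 1 0) => // s; rewrite /chart /edge_point;
  by congr pair; rewrite /= /GRing.scale/=; ring.
- apply: (E _ _ _ _ 0 0 (-1) 1) => // s; rewrite /chart /edge_point;
  by congr pair; rewrite /= /GRing.scale/=; ring.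
Qed.

Let phi_domain (f : R * R -> R) : continuous f ->
  \int[leb2 R]_(p in domain T) f (phi p) = \int[leb2 R]_(p in domain T') f p.
Proof.
move=> cf; rewrite [RHS]Rintegral_domain// (@Rintegral_domain _ T (f \o phi)).
  rewrite tdet_norm; congr *%R; apply: eq_Rintegral => p _ /=.
  by rewrite phi_chart.
move=> p; apply: continuous_comp; last exact: cf.
exact: (continuous_pair (@continuous_affine _ _ _ _)
  (@continuous_affine _ _ _ _)).
Qed.

(** Composition with the affine isometry phi, which takes the vertices of T to
    those of T', preserves all three integrals of a smooth function, so that the
    smooth quotients on T' also occur on T. *)
Lemma lambda1_le_congruent alpha : (lambda1 alpha T <= lambda1 alpha T')%E.
Proof.
apply: lambda1_ge_smooth => v sv m0.
have cv := smooth_C1 sv.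
have sphi : smooth (v \o phi) by exact: smooth_comp_affine.
have mE : mass T (v \o phi) = mass T' v.
  apply: (@phi_domain (fun p => v p ^+ 2)); apply: continuous_sqr.
  exact: C1_continuous.
have bE : bdmass T (v \o phi) = bdmass T' v.
  exact: (phi_edge (fun p => v p ^+ 2)).
have eE : energy T (v \o phi) = energy T' v.
  rewrite /energy -phi_domain; last first.
    by move=> p; apply: cvgD; apply: continuous_sqr; exact: cv.2.
  apply: eq_Rintegral => p _; rewrite /partial !derive_comp_affine -/phi.
  rewrite !(derive_partial _ (cv.1 _)) /=.
  have [r1 r2 r12] := orth.
  set x := partial false v _; set y := partial true v _.
  rewrite !mulr1 !mulr0 !add0r !addr0.
  transitivity ((k1 ^+ 2 + l1 ^+ 2) * x ^+ 2
      + 2 * (k1 * k2 + l1 * l2) * (x * y) + (k2 ^+ 2 + l2 ^+ 2) * y ^+ 2).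
    by ring.
  by rewrite r1 r2 r12; ring.
by have := @lambda1_le_smooth _ alpha T _ sphi; rewrite mE bE eE; exact.
Qed.
End transport.
End congruence.

(** * Inequalities between the sides of a triangle *)

Section geometry.
Context {R : realType}.
Implicit Types (T : triangle R) (w p X Y Z : R * R).

(** The formula of Heron, as [cross] is twice the area: after the squared lengths
    are expanded it is a polynomial identity in the coordinates. *)
Lemma heron X Y Z : 4 * cross (Y - X) (Z - X) ^+ 2 =
  ((dist2 Z X + dist2 X Y) ^+ 2 - dist2 Y Z ^+ 2) *
  (dist2 Y Z ^+ 2 - (dist2 Z X - dist2 X Y) ^+ 2).
Proof.
transitivity (2 * (dist2 Y Z ^+ 2 * dist2 Z X ^+ 2
    + dist2 Z X ^+ 2 * dist2 X Y ^+ 2 + dist2 X Y ^+ 2 * dist2 Y Z ^+ 2)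
  - (dist2 Y Z ^+ 2) ^+ 2 - (dist2 Z X ^+ 2) ^+ 2 - (dist2 X Y ^+ 2) ^+ 2).
  by rewrite !dist2_sqr /sqdist /cross /=; ring.
by ring.
Qed.

(** The field is w = t (X - I) / r, where I is the incentre and r the inradius. On
    the edges at X its flux is t times the length; on the opposite edge it is
    negative, since the fluxes of a constant field add up to 0. The last factor
    is (|X - I| / r)^2 in terms of the sides. *)
Lemma lambda1_le_vertex T X Y Z (t : R) :
  0 <= t -> cross (Y - X) (Z - X) = tdet T ->
  edges T =i [:: (X, Y); (Y, Z); (Z, X)] ->
  (lambda1 (- t) T <= (- (t ^+ 2 * (dist2 Z X * dist2 X Y *
    ((dist2 Z X + dist2 X Y) ^+ 2 - dist2 Y Z ^+ 2) / tdet T ^+ 2)))%:E)%E.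
Proof.
move=> t0 E eT; have d0 := tdet_neq0 T.
have D0 : 0 < `|tdet T| by rewrite normr_gt0.
(* |YZ| (X - I) + |ZX| (Y - I) + |XY| (Z - I) = 0 determines I, and
   r = |tdet T| / (|XY| + |YZ| + |ZX|); the perimeter cancels. *)
pose w := (t / `|tdet T|) *: (dist2 Z X *: (X - Y) + dist2 X Y *: (X - Z)).
have sgD : Num.sg (tdet T) * tdet T = `|tdet T| by rewrite -normrEsg.
have f1 : flux T w (X, Y) = t * dist2 X Y.
  transitivity (t / `|tdet T| * dist2 X Y
      * (Num.sg (tdet T) * cross (Y - X) (Z - X))).
    by rewrite /flux /w /cross /= /GRing.scale/=; ring.
  by rewrite E sgD; field; rewrite gt_eqF.
have f3 : flux T w (Z, X) = t * dist2 Z X.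
  transitivity (t / `|tdet T| * dist2 Z X
      * (Num.sg (tdet T) * cross (Y - X) (Z - X))).
    by rewrite /flux /w /cross /= /GRing.scale/=; ring.
  by rewrite E sgD; field; rewrite gt_eqF.
have f2 : flux T w (Y, Z) = - (flux T w (X, Y) + flux T w (Z, X)).
  by rewrite /flux /cross /=; ring.
have -> : t ^+ 2 * (dist2 Z X * dist2 X Y *
    ((dist2 Z X + dist2 X Y) ^+ 2 - dist2 Y Z ^+ 2) / tdet T ^+ 2) = dot w w.
  rewrite -(real_normK (num_real (tdet T))).
  transitivity ((t / `|tdet T|) ^+ 2 * (2 * dist2 Z X ^+ 2 * dist2 X Y ^+ 2
    + dist2 Z X * dist2 X Y
      * (dist2 Z X ^+ 2 + dist2 X Y ^+ 2 - dist2 Y Z ^+ 2))).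
    by field; rewrite gt_eqF.
  transitivity ((t / `|tdet T|) ^+ 2
    * (dist2 Z X ^+ 2 * sqdist X Y + dist2 X Y ^+ 2 * sqdist Z X
       + dist2 Z X * dist2 X Y * (sqdist Z X + sqdist X Y - sqdist Y Z))).
    by rewrite -!dist2_sqr; ring.
  by rewrite /dot /w /sqdist /= /GRing.scale/=; ring.
apply: lambda1_le_exp_dot => // e; rewrite eT !inE => /or3P[] /eqP -> /=.
- by rewrite f1.
- have p (A B : R * R) : 0 <= t * dist2 A B by rewrite mulr_ge0// sqrtr_ge0.
  by rewrite f2 f1 f3; have := p X Y; have := p Y Z; have := p Z X; lra.
- by rewrite f3.
Qed.

(** By the formula of Heron the claim is b c > a^2 - (b - c)^2. With b = a + y and
    c = a + z it reads a (y + z) + y z + (y - z)^2 > 0. *)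
Lemma vertex_ratio_gt4 (a b c D2 : R) : 0 < a -> 0 < b -> 0 < c -> 0 < D2 ->
  4 * D2 = ((b + c) ^+ 2 - a ^+ 2) * (a ^+ 2 - (b - c) ^+ 2) ->
  a <= b -> a <= c -> ~ (a = b /\ a = c) ->
  4 < b * c * ((b + c) ^+ 2 - a ^+ 2) / D2.
Proof.
move=> a0 b0 c0 D0 E ab ac ne.
rewrite ltr_pdivlMr// E [ltRHS]mulrC ltr_pM2l; last by nra.
have [y y0 bE] : exists2 y, 0 <= y & b = a + y by exists (b - a); lra.
have [z z0 cE] : exists2 z, 0 <= z & c = a + z by exists (c - a); lra.
have yz : 0 < y + z.
  rewrite lt_neqAle addr_ge0// andbT eq_sym paddr_eq0//.
  apply/negP => /andP[/eqP y00 /eqP z00]; apply: ne.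
  by rewrite bE cE y00 z00 addr0.
rewrite bE cE; have := mulr_gt0 a0 yz; have := mulr_ge0 y0 z0.
by have := sqr_ge0 (y - z); nra.
Qed.

(** The isoperimetric inequality for triangles: with x = b + c - a and its
    analogues y and z, whose sum is P = a + b + c, the formula of Heron reads
    4 D2 = P x y z, and the inequality between arithmetic and geometric mean of
    x, y, z is strict. The last equation says that the equilateral triangle of
    side l has the same area. *)
Lemma perimeter_gt (a b c l D2 : R) :
  0 < a -> 0 < b -> 0 < c -> 0 < D2 -> 0 < l ->
  4 * D2 = ((b + c) ^+ 2 - a ^+ 2) * (a ^+ 2 - (b - c) ^+ 2) ->
  4 * D2 = 3 * l ^+ 4 -> ~ (a = b /\ a = c) -> 3 * l < a + b + c.
Proof.
move=> a0 b0 c0 D0 l0 E El ne.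
pose x := b + c - a; pose y := a + c - b; pose z := a + b - c.
pose P := a + b + c.
have P0 : 0 < P by rewrite /P; lra.
have EP : 4 * D2 = P * (x * y * z) by rewrite E /P /x /y /z; ring.
have xyz : 0 < x * y * z.
  by rewrite -(pmulr_rgt0 _ P0) -EP; lra.
have xy0 : 0 < x + y by rewrite /x /y; lra.
have yz0 : 0 < y + z by rewrite /y /z; lra.
have zx0 : 0 < z + x by rewrite /z /x; lra.
(* the pairwise sums are positive, so at most one factor could be negative *)
have x0 : 0 < x.
  rewrite ltNge; apply/negP => x0; have y0 : 0 < y by lra.
  have z0 : 0 < z by lra.
  by have := mulr_gt0 y0 z0; nra.
have y0 : 0 < y.
  rewrite ltNge; apply/negP => y0; have z0 : 0 < z by lra.
  by have := mulr_gt0 x0 z0; nra.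
have z0 : 0 < z by move: xyz; rewrite pmulr_rgt0// mulr_gt0.
have am : 27 * (x * y * z) < P ^+ 3.
  have sq : 0 < (x - y) ^+ 2 + (y - z) ^+ 2 + (z - x) ^+ 2.
    rewrite lt_neqAle !addr_ge0 ?sqr_ge0// andbT eq_sym; apply/negP.
    rewrite !paddr_eq0 ?addr_ge0 ?sqr_ge0// !sqrf_eq0.
    move=> /andP[/andP[/eqP e1 /eqP e2] _].
    by apply: ne; rewrite /x /y /z in e1 e2; split; lra.
  have h1 := mulr_gt0 P0 sq.
  have h2 := mulr_ge0 (ltW x0) (sqr_ge0 (y - z)).
  have h3 := mulr_ge0 (ltW y0) (sqr_ge0 (z - x)).
  have h4 := mulr_ge0 (ltW z0) (sqr_ge0 (x - y)).
  have -> : P ^+ 3 = 27 * (x * y * z)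
     + P * ((x - y) ^+ 2 + (y - z) ^+ 2 + (z - x) ^+ 2) / 2
     + 3 * (x * (y - z) ^+ 2 + y * (z - x) ^+ 2 + z * (x - y) ^+ 2).
    by rewrite /P /x /y /z; field.
  lra.
rewrite -/P ltNge; apply/negP => Pl.
have : P ^+ 4 <= (3 * l) ^+ 4 by rewrite lerXn2r// nnegrE; lra.
have := ltr_pM2l P0 (27 * (x * y * z)) (P ^+ 3); rewrite am => PP.
rewrite exprMn (_ : 3 ^+ 4 = 27 * 3 :> R); last by ring.
by rewrite -mulrA -El EP [P ^+ 4]exprS; lra.
Qed.
End geometry.

(** * Comparison with the equilateral triangle *)

Section triangle_bounds.
Context {R : realType}.
Implicit Types (T : triangle R).

Lemma edge_lengths_gt0 T : [/\ 0 < dist2 (vA T) (vB T),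
  0 < dist2 (vB T) (vC T) & 0 < dist2 (vC T) (vA T)].
Proof.
by split; [apply: (@edge_length_gt0 _ T (vA T, vB T))
  |apply: (@edge_length_gt0 _ T (vB T, vC T))
  |apply: (@edge_length_gt0 _ T (vC T, vA T))]; rewrite !inE eqxx ?orbT.
Qed.

(** The vertex opposite to a shortest side is the farthest from the incentre. *)
Lemma lambda1_le_nonequilateral T : ~ equilateral T -> exists2 k : R, 4 < k &
  forall t, 0 <= t -> (lambda1 (- t) T <= (- (t ^+ 2 * k))%:E)%E.
Proof.
move=> ne; have [c0 a0 b0] := edge_lengths_gt0 T.
have d0 := tdet_neq0 T.
have D0 : 0 < tdet T ^+ 2 by rewrite lt_neqAle sqr_ge0 andbT eq_sym sqrf_eq0.
have main X Y Z : cross (Y - X) (Z - X) = tdet T ->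
  edges T =i [:: (X, Y); (Y, Z); (Z, X)] ->
  0 < dist2 Y Z -> 0 < dist2 Z X -> 0 < dist2 X Y ->
  ~ (dist2 Y Z = dist2 Z X /\ dist2 Y Z = dist2 X Y) ->
  dist2 Y Z <= dist2 Z X -> dist2 Y Z <= dist2 X Y ->
  exists2 k : R, 4 < k &
    forall t, 0 <= t -> (lambda1 (- t) T <= (- (t ^+ 2 * k))%:E)%E.
  move=> E eT a00 b00 c00 nne ab ac; have H := heron X Y Z; rewrite E in H.
  eexists; first exact: (vertex_ratio_gt4 a00 b00 c00 D0 H ab ac nne).
  by move=> t t0; exact: lambda1_le_vertex.
have [E2 E3] : cross (vC T - vB T) (vA T - vB T) = tdet T /\
    cross (vA T - vC T) (vB T - vC T) = tdet T.
  by rewrite /tdet /cross /=; split; ring.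
have [ab|ba] := leP (dist2 (vB T) (vC T)) (dist2 (vC T) (vA T)).
  have [ac|ca] := leP (dist2 (vB T) (vC T)) (dist2 (vA T) (vB T)).
    apply: (main (vA T) (vB T) (vC T)) => //.
    by move=> [e1 e2]; apply: ne; split; lra.
  apply: (main (vC T) (vA T) (vB T)) => //; try lra.
  by move=> e; rewrite !inE orbA orbC.
have [bc|cb] := leP (dist2 (vC T) (vA T)) (dist2 (vA T) (vB T)).
  apply: (main (vB T) (vC T) (vA T)) => //; try lra.
  by move=> e; rewrite !inE orbC orbA.
apply: (main (vC T) (vA T) (vB T)) => //; try lra.
by move=> e; rewrite !inE orbA orbC.
Qed.

Lemma equilateral_tdet T :
  equilateral T -> 4 * tdet T ^+ 2 = 3 * dist2 (vA T) (vB T) ^+ 4.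
Proof.
move=> [e1 e2]; have := heron (vA T) (vB T) (vC T); rewrite -/(tdet T) => ->.
by rewrite -e2 -e1; ring.
Qed.

(** The incentre is the centroid, and no point of the triangle is farther from it
    than the circumradius, which is twice the inradius. *)
Lemma lambda1_ge_equilateral T (t : R) : equilateral T -> 0 <= t ->
  ((- (t * (2 * perimeter T / `|tdet T|) + t ^+ 2 * 4))%:E <= lambda1 (- t) T)%E.
Proof.
move=> eq t0; have [e1 e2] := eq; have [l0 _ _] := edge_lengths_gt0 T.
set l := dist2 (vA T) (vB T) in l0.
have D0 : 0 < `|tdet T| by rewrite normr_gt0 tdet_neq0.
have E := equilateral_tdet eq; rewrite -/l in E.
pose r := `|tdet T| / (3 * l).
have r0 : 0 < r by rewrite divr_gt0// mulr_gt0.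
have Pe : perimeter T = 3 * l.
  by rewrite /perimeter /edges !big_cons big_nil /= -e2 -e1 -/l; ring.
have -> : 2 * perimeter T / `|tdet T| = 2 / r.
  by rewrite Pe /r; field; rewrite !gt_eqF.
pose I : R * R := 3^-1 *: (vA T + vB T + vC T).
have sgD : Num.sg (tdet T) * tdet T = `|tdet T| by rewrite -normrEsg.
apply: (@lambda1_ge_incircle _ T t r 4 I) => //.
- have rl : r * l = 3^-1 * (Num.sg (tdet T) * tdet T).
    by rewrite sgD /r; field; rewrite gt_eqF.
  move=> e; rewrite !inE => /or3P[] /eqP -> /=;
    rewrite -?e2 -?e1 -/l rl mulrCA; congr (_ * _);
    by rewrite /I /tdet /cross /= /GRing.scale/=; field.
- move=> p [a [b [c [a00 b00 c00 abc ->]]]].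
  (* the square of the circumradius, by the value of the area *)
  have -> : 4 * r ^+ 2 = l ^+ 2 / 3.
    rewrite /r expr_div_n real_normK ?num_real//.
    have -> : tdet T ^+ 2 = 3 * l ^+ 4 / 4 by lra.
    by field; rewrite gt_eqF.
  have s1 := dist2_sqr (vA T) (vB T).
  have s2 := dist2_sqr (vB T) (vC T).
  have s3 := dist2_sqr (vC T) (vA T).
  rewrite -e2 -e1 -/l /sqdist in s1 s2 s3.
  pose u := vB T - vA T; pose w := vC T - vA T.
  have uu : dot u u = l ^+ 2 by rewrite s1 /dot /u /=; ring.
  have ww : dot w w = l ^+ 2 by rewrite s3 /dot /w /=; ring.
  have uw : dot u w = l ^+ 2 / 2.
    apply: (mulfI (_ : (2 : R) != 0)) => //; rewrite [RHS]mulrC divfK//.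
    by rewrite /dot /u /w /=; lra.
  have aE : a = 1 - b - c by lra.
  rewrite (_ : dot _ _ = (b - 3^-1) ^+ 2 * dot u u + (c - 3^-1) ^+ 2 * dot w w +
     2 * (b - 3^-1) * (c - 3^-1) * dot u w); last first.
    by rewrite aE /dot /u /w /I /= /GRing.scale/=; field.
  rewrite uu ww uw.
  have h1 := mulr_ge0 (mulr_ge0 (ltW a00) (ltW b00)) (sqr_ge0 l).
  have h2 : 0 <= c * (1 - c) * l ^+ 2 by rewrite !mulr_ge0 ?sqr_ge0//; lra.
  rewrite aE in h1; nra.
Qed.

Lemma exprn4_inj (x y : R) : 0 < x -> 0 < y -> x ^+ 4 = y ^+ 4 -> x = y.
Proof. by move=> x0 y0; apply: pexpIrn; rewrite ?nnegrE ?ltW. Qed.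

Lemma lambda1_le_equilateral T T' alpha : equilateral T -> equilateral T' ->
  `|tdet T| = `|tdet T'| -> (lambda1 alpha T <= lambda1 alpha T')%E.
Proof.
move=> eT eT' hD; have [c b] := eT; have [c' b'] := eT'.
have [l0 _ _] := edge_lengths_gt0 T; have [l0' _ _] := edge_lengths_gt0 T'.
have h : 3 * dist2 (vA T) (vB T) ^+ 4 = 3 * dist2 (vA T') (vB T') ^+ 4.
  rewrite -!equilateral_tdet// -(real_normK (num_real (tdet T))) hD.
  by rewrite real_normK ?num_real.
have l : dist2 (vA T) (vB T) = dist2 (vA T') (vB T').
  by apply: (exprn4_inj l0 l0'); lra.
have lBC : dist2 (vB T) (vC T) = dist2 (vB T') (vC T') by rewrite -c -c'.
have lCA : dist2 (vC T) (vA T) = dist2 (vC T') (vA T') by rewrite -b -b'.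
exact: lambda1_le_congruent.
Qed.

Lemma perimeter_gt_equilateral T T' : ~ equilateral T -> equilateral T' ->
  `|tdet T| = `|tdet T'| -> perimeter T' < perimeter T.
Proof.
move=> ne eT' hD; have [c' b'] := eT'.
have [c0 a0 b0] := edge_lengths_gt0 T; have [l0' _ _] := edge_lengths_gt0 T'.
have D2 : 0 < tdet T ^+ 2.
  by rewrite lt_neqAle sqr_ge0 andbT eq_sym sqrf_eq0 tdet_neq0.
have E := equilateral_tdet eT'.
rewrite -(real_normK (num_real (tdet T'))) -hD real_normK ?num_real// in E.
have nabc : ~ (dist2 (vB T) (vC T) = dist2 (vC T) (vA T) /\
    dist2 (vB T) (vC T) = dist2 (vA T) (vB T)).
  by move=> [e1 e2]; apply: ne; split; lra.
have := perimeter_gt a0 b0 c0 D2 l0' (heron (vA T) (vB T) (vC T)) E nabc.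
by rewrite /perimeter !edge_sum /= -b' -c'; lra.
Qed.

(** The two regimes of the comparison: the quadratic terms decide for large t, the
    linear ones for small t. *)
Lemma robin_thresholds (c P P' k : R) : 0 < c -> P' < P -> 4 < k ->
  exists t1 t2 : R, [/\ 0 < t2, t2 <= t1,
    forall t, t1 <= t -> t * (c * P') + t ^+ 2 * 4 <= t ^+ 2 * k &
    forall t, 0 <= t -> t <= t2 -> t * (c * P') + t ^+ 2 * 4 <= t * (c * P)].
Proof.
move=> c0 PP k4; pose t2 := c * (P - P') / 4.
have t20 : 0 < t2 by rewrite divr_gt0// mulr_gt0// subr_gt0.
exists (Num.max (c * P' / (k - 4)) t2), t2; split => //.
- by rewrite le_max lexx orbT.
- move=> t; rewrite ge_max => /andP[]; rewrite ler_pdivrMr ?subr_gt0// => h tt.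
  by have t0 : 0 <= t by [lra]; have := ler_wpM2l t0 h; lra.
- move=> t t0; rewrite ler_pdivlMr// => h.
  by have := ler_wpM2l t0 h; lra.
Qed.

End triangle_bounds.

Theorem theorem1p2 (R : realType) (Tstar T : triangle R)
    (hstar : equilateral Tstar)
    (harea : leb2 R (domain T) = leb2 R (domain Tstar)) :
  exists alpha1 alpha2 : R,
    [/\ alpha1 <= alpha2, alpha2 < 0 &
        forall alpha : R,
          (alpha <= alpha1) || (alpha2 <= alpha < 0) ->
          (lambda1 alpha T <= lambda1 alpha Tstar)%E].
Proof.
have hD : `|tdet T| = `|tdet Tstar|.
  by move: harea; rewrite !measure_domain => -[]; lra.
have [eqT|neT] := pselect (equilateral T).
  (* the triangles are congruent, and any pair of thresholds will do *)
  exists (-1), (-1); split; [exact: lexx|by rewrite oppr_lt0|move=> alpha _].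
  exact: lambda1_le_equilateral.
have [k k4 upk] := lambda1_le_nonequilateral neT.
have c0 : 0 < 2 / `|tdet T| by rewrite divr_gt0// normr_gt0 tdet_neq0.
have PP := perimeter_gt_equilateral neT hstar hD.
have [t1 [t2 [t20 t21 large small]]] := robin_thresholds c0 PP k4.
have lower t : 0 <= t ->
    ((- (t * (2 / `|tdet T| * perimeter Tstar) + t ^+ 2 * 4))%:E
     <= lambda1 (- t) Tstar)%E.
  move=> t0; have := lambda1_ge_equilateral hstar t0.
  by rewrite -hD (mulrAC 2).
exists (- t1), (- t2); split; [by rewrite lerN2|by rewrite oppr_lt0|move=> alpha].
rewrite -(opprK alpha); move: (- alpha) => t; rewrite !lerN2 oppr_lt0.
move=> /orP[tt1|/andP[tt2 t0]].
  have t0 : 0 <= t by rewrite (le_trans (ltW t20))// (le_trans t21).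
  apply: (le_trans (upk t t0)); apply: le_trans (lower t t0).
  by rewrite lee_fin lerN2; exact: large.
apply: (le_trans (lambda1_le_cst T (- t))).
apply: le_trans (lower t (ltW t0)).
by rewrite lee_fin mulNr lerN2 (mulrAC 2 (perimeter T)); exact: small (ltW t0) tt2.
Qed.
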